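(* Let $V$ be an $\mathbb{R}^d$-valued random vector whose law $P_V$ has a Lebesgue density $f_V$, and assume that its characteristic function satisfies $\varphi_V(\omega)\neq 0$ for Lebesgue-a.e. $\omega\in\mathbb{R}^d$. Then for every $\lambda\in C_0(\mathbb{R}^d;\mathbb{C})$ there exists a unique continuous linear functional $\mathcal{T}_{\lambda,V}\in\mathcal{A}_V'(\mathbb{R}^d)$ such that \[ \mathcal{T}_{\lambda,V}\bigl[\mathcal{K}_V[\mu]\bigr]=\int_{\mathbb{R}^d}\lambda(x)\,d\mu(x)\qquad\text{for all }\mu\in\mathcal{M}(\mathbb{R}^d). \] In particular, if $X$ is an $\mathbb{R}^d$-valued random vector independent of $V$ with law $P_X$ and $Y=X+V$, then the density of $Y$ is $f_Y=\mathcal{K}_V[P_X]$ and \[ \mathcal{T}_{\lambda,V}[f_Y]=\int_{\mathbb{R}^d}\lambda(x)\,dP_X(x). \]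
   Context: $\varphi_V(\omega)=\mathbb{E}[e^{i\omega^\top V}]$. $\mathcal{M}(\mathbb{R}^d)$ is the Banach space of finite signed (complex allowed) Radon measures on $\mathbb{R}^d$ with the total variation norm $\|\mu\|_{TV}=\sup\{|\int h\,d\mu|: h\in C_0(\mathbb{R}^d),\|h\|_\infty\le 1\}$. The convolution operator is $\mathcal{K}_V[\mu](y)=(f_V*\mu)(y)=\int f_V(y-x)\,d\mu(x)$, mapping $\mathcal{M}(\mathbb{R}^d)$ into $L^1(\mathbb{R}^d;\mathbb{C})$. The space of $V$-admissible mixtures is $\mathcal{A}_V(\mathbb{R}^d)=\{f_V*\mu:\mu\in\mathcal{M}(\mathbb{R}^d)\}$; under the nonvanishing assumption on $\varphi_V$ the representing measure $\mu$ of each $f\in\mathcal{A}_V$ is unique and $\mathcal{A}_V$ is normed by $\|f\|_{\mathcal{A}_V}=\|\mu\|_{TV}$ where $f=f_V*\mu$. $\mathcal{A}_V'(\mathbb{R}^d)$ denotes the space of continuous linear functionals on $(\mathcal{A}_V(\mathbb{R}^d),\|\cdot\|_{\mathcal{A}_V})$. $C_0$ denotes continuous functions vanishing at infinity. *)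

(* Defs.v *)
From HB Require Import structures.
From mathcomp Require Import all_boot all_order all_algebra.
From mathcomp Require Import all_classical all_reals all_analysis.
From mathcomp Require Import complex.

Set Implicit Arguments.
Unset Strict Implicit.
Unset Printing Implicit Defensive.

Import Order.TTheory GRing.Theory Num.Theory.
Local Open Scope ring_scope.
Local Open Scope classical_set_scope.

Section Defs.
Context {R : realType} {d : nat}.
Local Notation Rd := (d.-tuple R).
(* R^d is modelled by [d.-tuple R], equipped with the library's product
   (= Borel) sigma-algebra built from the Borel sigma-algebra of R. *)

Definition tadd (x y : Rd) : Rd := [tuple tnth x i + tnth y i | i < d].
Definition tsub (x y : Rd) : Rd := [tuple tnth x i - tnth y i | i < d].
Definition tdot (x y : Rd) : R := \sum_(i < d) tnth x i * tnth y i.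
(* sup-norm on R^d (all norms on R^d are equivalent) *)
Definition tnorm (x : Rd) : R := \big[Num.max/0]_(i < d) `|tnth x i|.

Definition creal (z : R[i]) : R := let: Complex a _ := z in a.
Definition cimag (z : R[i]) : R := let: Complex _ b := z in b.
Definition cnorm (z : R[i]) : R := Normc.normc z.

Definition box (a b : Rd) : set Rd :=
  [set x | forall i, tnth a i <= tnth x i <= tnth b i].
(* [leb] is (Borel) Lebesgue measure on R^d: the measure giving every box its
   volume (this characterizes it uniquely on the Borel sets). *)
Definition is_lebesgue (leb : {measure set Rd -> \bar R}) : Prop :=
  forall a b : Rd, (forall i, tnth a i <= tnth b i) ->
    leb (box a b) = (\prod_(i < d) (tnth b i - tnth a i))%:E.

Definition law {dT} {Omega : measurableType dT} (P : probability Omega R)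
  (Z : Omega -> Rd) : set Rd -> \bar R := fun A => P (Z @^-1` A).

Definition is_density (leb : {measure set Rd -> \bar R})
  (m : set Rd -> \bar R) (f : Rd -> R) : Prop :=
  [/\ measurable_fun setT f, (forall x, 0 <= f x) &
      forall A, measurable A -> m A = (\int[leb]_(x in A) (f x)%:E)%E].

Definition independent {dT} {Omega : measurableType dT}
  (P : probability Omega R) (X Y : Omega -> Rd) : Prop :=
  forall A B : set Rd, measurable A -> measurable B ->
    P (X @^-1` A `&` Y @^-1` B) = (P (X @^-1` A) * P (Y @^-1` B))%E.

Definition charfun {dT} {Omega : measurableType dT}
  (P : probability Omega R) (V : Omega -> Rd) (w : Rd) : R[i] :=
  Complex (Rintegral P setT (fun o => cos (tdot w (V o))))
          (Rintegral P setT (fun o => sin (tdot w (V o)))).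

(* Every finite complex measure is (by Jordan decomposition)
   mu = (m1 - m2) + i (m3 - m4) with finite positive measures m1..m4. *)
Record cmeasure := CMeasure {
  cm_rpos : {finite_measure set Rd -> \bar R};
  cm_rneg : {finite_measure set Rd -> \bar R};
  cm_ipos : {finite_measure set Rd -> \bar R};
  cm_ineg : {finite_measure set Rd -> \bar R} }.

Definition cm_of (m : {finite_measure set Rd -> \bar R}) : cmeasure :=
  CMeasure m mzero mzero mzero.

Definition cint (mu : cmeasure) (h : Rd -> R[i]) : R[i] :=
  let a := fun x => creal (h x) in
  let b := fun x => cimag (h x) in
  let s (m : {finite_measure set Rd -> \bar R}) f := Rintegral m setT f in
  Complex ((s (cm_rpos mu) a - s (cm_rneg mu) a)
              - (s (cm_ipos mu) b - s (cm_ineg mu) b))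
          ((s (cm_rpos mu) b - s (cm_rneg mu) b)
              + (s (cm_ipos mu) a - s (cm_ineg mu) a)).

Definition C0fun (h : Rd -> R[i]) : Prop :=
  (forall (x : Rd) (e : R), 0 < e -> exists2 delta : R, 0 < delta &
      forall y, tnorm (tsub y x) < delta -> cnorm (h y - h x) < e) /\
  (forall e : R, 0 < e -> exists M : R, forall x, M < tnorm x -> cnorm (h x) < e).

Definition tvnorm (mu : cmeasure) : R :=
  sup [set r : R | exists h, [/\ C0fun h, (forall x, cnorm (h x) <= 1) &
                                 r = cnorm (cint mu h)]].

Definition Kconv (fV : Rd -> R) (mu : cmeasure) : Rd -> R[i] :=
  fun y => cint mu (fun x => (fV (tsub y x))%:C%C).

(* elements of A_V are L^1 classes: f in A_V iff f = f_V * mu Lebesgue-a.e. *)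
Definition inAV (leb : {measure set Rd -> \bar R}) (fV : Rd -> R)
  (f : Rd -> R[i]) : Prop :=
  exists mu : cmeasure, {ae leb, forall y, f y = Kconv fV mu y}.

(* ||f||_{A_V} = ||mu||_TV for the (unique, under the standing assumption)
   representing measure mu of f *)
Definition AVnorm (leb : {measure set Rd -> \bar R}) (fV : Rd -> R)
  (f : Rd -> R[i]) : R :=
  inf [set tvnorm mu | mu in [set mu | {ae leb, forall y, f y = Kconv fV mu y}]].

(* T is an element of A_V'(R^d): a functional on (L^1 classes of) A_V that is
   complex-linear and bounded (= continuous) for ||.||_{A_V}.  Values of T
   outside A_V are irrelevant. *)
Definition AVdual (leb : {measure set Rd -> \bar R}) (fV : Rd -> R)
  (T : (Rd -> R[i]) -> R[i]) : Prop :=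
  [/\ (forall f g, inAV leb fV f -> {ae leb, forall y, f y = g y} -> T f = T g),
      (forall f g (a b : R[i]), inAV leb fV f -> inAV leb fV g ->
          T (fun y => a * f y + b * g y) = a * T f + b * T g) &
      (exists C : R, forall f, inAV leb fV f ->
          cnorm (T f) <= C * AVnorm leb fV f)].

End Defs.

(* Main.v *)
Require Import Defs.
From HB Require Import structures.
From mathcomp Require Import all_boot all_order all_algebra.
From mathcomp Require Import all_classical all_reals all_analysis.
From mathcomp Require Import measurable_realfun complex.
From mathcomp Require Import ring lra.
Import Order.TTheory GRing.Theory Num.Theory.
Import numFieldNormedType.Exports.
Local Open Scope ring_scope.
Local Open Scope classical_set_scope.

Set Implicit Arguments.
Unset Strict Implicit.
Unset Printing Implicit Defensive.

(** The functional sends [f_V * mu] to the integral of [lambda] against [mu];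
    everything rests on [mu] being determined, on [C_0], by [f_V * mu].
    If [f_V * p = f_V * q] a.e. for finite positive measures [p] and [q], the
    images of [p x P_V] and [q x P_V] under addition agree, so the
    characteristic functions of [p] and [q] agree wherever that of [V] does not
    vanish; this set is dense, so they agree everywhere by continuity.  Hence
    [p] and [q] have the same integrals of trigonometric polynomials.
    To pass to a bounded continuous [h], write the Bernstein operator of degree
    [n^3] in the variables [u_i = (1 + sin (pi x_i / (2 n))) / 2]: Bernstein
    polynomials in the [u_i] are trigonometric polynomials in [x], bounded by
    [sup |h|], and converge pointwise to [h] on the whole space (the change of
    variable costs a factor [n^2] in Chebyshev's estimate, against a variance
    [1 / n^3]), so dominated convergence concludes. *)

(** * Borel structure of the space of tuples *)

Section tuple_space.
Context {R : realType} {d : nat}.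
Local Notation Rd := (d.-tuple R).

Definition cst_tuple (c : R) : Rd := [tuple c | i < d].

Lemma tsubK (x y : Rd) : tadd (tsub x y) y = x.
Proof. by apply: eq_from_tnth => i; rewrite !tnth_mktuple subrK. Qed.

Lemma taddC (x y : Rd) : tadd x y = tadd y x.
Proof. by apply: eq_from_tnth => i; rewrite !tnth_mktuple addrC. Qed.

Lemma tdotDr (w x y : Rd) : tdot w (tadd x y) = tdot w x + tdot w y.
Proof.
by rewrite -big_split; apply: eq_bigr => i _; rewrite tnth_mktuple mulrDr.
Qed.

Lemma tdotDl (w w' x : Rd) : tdot (tadd w w') x = tdot w x + tdot w' x.
Proof.
by rewrite -big_split; apply: eq_bigr => i _; rewrite tnth_mktuple mulrDl.
Qed.

Lemma tdotBl (w w' x : Rd) : tdot (tsub w w') x = tdot w x - tdot w' x.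
Proof.
rewrite /tdot -sumrB.
by apply: eq_bigr => i _; rewrite tnth_mktuple mulrBl.
Qed.

Lemma tnorm_ge0 (x : Rd) : 0 <= tnorm x.
Proof. by rewrite /tnorm; elim/big_ind : _ => // a b a0 b0; rewrite le_max a0. Qed.

Lemma tnorm_ltP (x : Rd) (e : R) : 0 < e ->
  reflect (forall i, `|tnth x i| < e) (tnorm x < e).
Proof.
move=> e0; rewrite /tnorm; apply: (iffP idP) => [xe i|xe].
  by apply: le_lt_trans xe; rewrite (bigD1 i)//= le_max lexx.
by elim/big_ind : _ => // a b ae be; rewrite gt_max ae.
Qed.

Lemma tnorm_leP (x : Rd) (e : R) : 0 <= e ->
  reflect (forall i, `|tnth x i| <= e) (tnorm x <= e).
Proof.
move=> e0; rewrite /tnorm; apply: (iffP idP) => [xe i|xe].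
  by apply: le_trans xe; rewrite (bigD1 i)//= le_max lexx.
by elim/big_ind : _ => // a b ae be; rewrite ge_max ae.
Qed.

Lemma measurable_coord (i : 'I_d) :
  measurable_fun setT (fun x : Rd => tnth x i).
Proof. exact: measurable_tnth. Qed.

Lemma measurable_mktuple {dT} {T : measurableType dT} (f : 'I_d -> T -> R) :
  (forall i, measurable_fun setT (f i)) ->
  measurable_fun setT (fun x => [tuple f i x | i < d] : Rd).
Proof.
move=> mf; apply/measurable_fun_tnthP => i.
rewrite [X in measurable_fun _ X](_ : _ = f i)//.
by apply/funext => x /=; rewrite tnth_mktuple.
Qed.

Lemma measurable_tadd :
  measurable_fun setT (fun z : Rd * Rd => tadd z.1 z.2).
Proof.
apply: measurable_mktuple => i.
by apply: measurable_funD; apply: (measurableT_comp (measurable_coord i)).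
Qed.

Lemma measurable_tsub :
  measurable_fun setT (fun z : Rd * Rd => tsub z.1 z.2).
Proof.
apply: measurable_mktuple => i.
by apply: measurable_funB; apply: (measurableT_comp (measurable_coord i)).
Qed.

Lemma measurable_tdot (w : Rd) : measurable_fun setT (tdot w).
Proof.
apply: measurable_sum => i; apply: measurable_funM => //.
exact: measurable_coord.
Qed.

Lemma boxE (a b : Rd) : box a b =
  \bigcap_(i in setT) ((@tnth d R)^~ i @^-1` `[tnth a i, tnth b i]).
Proof.
apply/seteqP; split=> x /=.
  by move=> xab i _; rewrite /= in_itv/=.
by move=> xab i; have := xab i I; rewrite /= in_itv.
Qed.

Lemma measurable_box (a b : Rd) : measurable (box a b).
Proof.
rewrite boxE; apply: fin_bigcap_measurable => [|i _]; first exact: finite_finset.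
by rewrite -[X in measurable X]setTI; apply: measurable_coord.
Qed.

Definition boxes : set (set Rd) := [set A | exists a b, A = box a b].

(** Boxes with a lower bound above the upper one are empty but still count as boxes, so taking
    coordinatewise maxima and minima needs no case distinction. *)
Lemma boxes_setI_closed : setI_closed boxes.
Proof.
move=> _ _ [a [b ->]] [a' [b' ->]].
exists [tuple Num.max (tnth a i) (tnth a' i) | i < d].
exists [tuple Num.min (tnth b i) (tnth b' i) | i < d].
apply/seteqP; split=> x /=.
  move=> [xab xab'] i; rewrite !tnth_mktuple ge_max le_min.
  by have /andP[-> ->] := xab i; have /andP[-> ->] := xab' i.
move=> H; split=> i; have := H i; rewrite !tnth_mktuple ge_max le_min.
  by move=> /andP[/andP[-> _] /andP[-> _]].
by move=> /andP[/andP[_ ->] /andP[_ ->]].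
Qed.

Lemma bigcup_box : \bigcup_n box (cst_tuple (- n%:R)) (cst_tuple n%:R) = setT.
Proof.
apply/seteqP; split=> // x _.
exists (Num.bound (tnorm x)) => // i; rewrite !tnth_mktuple -ler_norml.
have x0 := tnorm_ge0 x.
apply: le_trans (ltW (archi_boundP x0)).
exact: (tnorm_leP _ x0 _).
Qed.

(** The product sigma-algebra is generated by the coordinates, and the preimage of a closed ray
    under a coordinate is a countable union of boxes. With [boxes_setI_closed], a measure finite on
    boxes is determined by its values on them. *)
Lemma measurable_boxes : @measurable _ Rd = <<s boxes >>.
Proof.
apply/seteqP; split; last first.
  apply: smallest_sub; first exact: sigma_algebra_measurable.
  by move=> _ [a [b ->]]; exact: measurable_box.
apply: smallest_sub; first exact: smallest_sigma_algebra.
move=> A; rewrite -bigcup_seq/= => -[i _] [B mB <-].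
(* The coordinate map is read on the space whose measurable sets are those generated by boxes; its
   measurability there is the inclusion to prove. *)
pose f : g_sigma_algebraType boxes -> R := fun x => tnth x i.
suff mf : measurable_fun setT f by exact: (mf measurableT B mB).
apply: (measurability _ (RGenCInfty.measurableE R)) => _ [_ [x ->] <-].
rewrite setTI [X in measurable X](_ : _ = \bigcup_n
   box [tuple (if j == i then x else - n%:R) | j < d] (cst_tuple n%:R)).
  apply: bigcup_measurable => n _.
  by apply: sub_sigma_algebra; eexists; eexists.
apply/seteqP; split=> y /=.
  rewrite in_itv/= andbT => xy.
  have : setT y by [].
  rewrite -bigcup_box => -[n _ yn]; exists n => // j; have := yn j.
  rewrite !tnth_mktuple => /andP[yn1 ->]; rewrite andbT.
  by case: eqP => // ->.
move=> [n _ /(_ i)]; rewrite !tnth_mktuple eqxx in_itv/= andbT.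
by move=> /andP[].
Qed.

End tuple_space.

(** * Lebesgue measure and convolution *)

Section lebesgue.
Context {R : realType} {d : nat}.
Local Notation Rd := (d.-tuple R).
Variable leb : {measure set Rd -> \bar R}.
Hypothesis lebP : is_lebesgue leb.

Lemma is_lebesgue_box_lty (a b : Rd) : (leb (box a b) < +oo)%E.
Proof.
have [ab|/existsNP[i /negP abi]] := pselect (forall i, tnth a i <= tnth b i).
  by rewrite lebP// ltry.
rewrite (_ : box a b = set0) ?measure0//; apply/seteqP; split => // x /(_ i).
by move=> /andP[ax xb]; apply: (negP abi); apply: le_trans xb.
Qed.

Lemma is_lebesgue_sigma_finite : sigma_finite setT leb.
Proof.
exists (fun n => box (cst_tuple (- n%:R)) (cst_tuple n%:R)).
  by rewrite bigcup_box.
by move=> n; split; [exact: measurable_box|exact: is_lebesgue_box_lty].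
Qed.

Lemma measurable_translation (x : Rd) : measurable_fun setT (tsub^~ x : Rd -> Rd).
Proof. exact: (measurableT_comp measurable_tsub (pair2_measurable x)). Qed.

(** [leb] and its image under a translation agree on boxes, a generating class stable under
    intersection, and the centred boxes exhausting the space have finite measure; the two measures
    therefore coincide. *)
Lemma is_lebesgue_translation (x : Rd) (A : set Rd) : measurable A ->
  leb ((tsub^~ x) @^-1` A) = leb A.
Proof.
move=> mA; apply/esym.
pose m2 : {measure set Rd -> \bar R} := pushforward leb (tsub^~ x).
have boxn n : boxes (box (cst_tuple (- n%:R)) (cst_tuple n%:R) : set Rd).
  by eexists; eexists.
apply: (measure_unique _ _ measurable_boxes boxes_setI_closed boxn bigcup_box
  leb (m2 (measurable_translation x))) => //.
- move=> _ [a [b ->]]; rewrite /m2/= /pushforward.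
  have -> : tsub^~ x @^-1` box a b = box (tadd a x) (tadd b x).
    apply/seteqP; split=> y H i; have := H i; rewrite !tnth_mktuple.
      by rewrite lerBrDr lerBlDr.
    by rewrite lerBrDr lerBlDr.
  have [ab|/existsNP[i /negP abi]] := pselect (forall i, tnth a i <= tnth b i).
    rewrite !lebP//; last by move=> i; rewrite !tnth_mktuple lerD2r.
    congr EFin; apply: eq_bigr => i _; rewrite !tnth_mktuple; ring.
  rewrite (_ : box a b = set0); last first.
    apply/seteqP; split => // y /(_ i)/andP[ax xb].
    by apply: (negP abi); apply: le_trans xb.
  rewrite (_ : box _ _ = set0)//.
  apply/seteqP; split => // y /(_ i); rewrite !tnth_mktuple => /andP[ax xb].
  by apply: (negP abi); rewrite -(lerD2r (tnth x i)); apply: le_trans xb.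
- by move=> n; exact: is_lebesgue_box_lty.
Qed.

Lemma ge0_integral_translation (x : Rd) (g : Rd -> \bar R) :
  measurable_fun setT g -> (forall y, 0 <= g y)%E ->
  (\int[leb]_y g (tsub y x) = \int[leb]_y g y)%E.
Proof.
move=> mg g0.
have := @ge0_integral_pushforward _ _ _ _ _ _ (measurable_translation x) leb setT g
   measurableT mg (fun y _ => g0 y).
rewrite preimage_setT => <-.
apply: eq_measure_integral => [|mt A mA _]; first exact: measurable_translation.
exact: is_lebesgue_translation.
Qed.

End lebesgue.

Section convolution.
Context {R : realType} {d : nat}.
Local Notation Rd := (d.-tuple R).
Local Open Scope ereal_scope.

(** Convolution of a positive measure with a density, kept in the extended reals so that Tonelli
    applies before any finiteness is known; [Kconv] is built from the [fine] of such values. *)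
Definition econv (m : {measure set Rd -> \bar R}) (f : Rd -> R) (y : Rd) :=
  \int[m]_x (f (tsub y x))%:E.

Variable leb : {measure set Rd -> \bar R}.
Hypothesis lebP : is_lebesgue leb.
Variables (nu : probability Rd R) (f : Rd -> R).
Hypothesis nuf : is_density leb nu f.

Let mf : measurable_fun setT f. Proof. by case: nuf. Qed.
Let f0 x : (0 <= f x)%R. Proof. by case: nuf. Qed.

Lemma econv_ge0 m y : 0 <= econv m f y.
Proof. by apply: integral_ge0 => x _; rewrite lee_fin. Qed.

Lemma measurable_translate_density y :
  measurable_fun setT (fun x => (f (tsub y x))%:E).
Proof.
apply/measurable_EFinP; apply: measurableT_comp => //.
exact: (measurableT_comp measurable_tsub (pair1_measurable y)).
Qed.

Section finite_measure.
Variable m : {finite_measure set Rd -> \bar R}.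

Let mf2 : measurable_fun setT (fun z : Rd * Rd => (f (tsub z.2 z.1))%:E).
Proof.
apply/measurable_EFinP; apply: measurableT_comp => //.
exact: (measurableT_comp measurable_tsub
  (measurable_fun_pair measurable_snd measurable_fst)).
Qed.

Lemma measurable_econv : measurable_fun setT (econv m f).
Proof.
apply: (@measurable_fun_fubini_tonelli_G _ _ _ _ _ m
   (fun z : Rd * Rd => (f (tsub z.2 z.1))%:E)) => //.
by move=> z; rewrite lee_fin.
Qed.

(** Sigma-finiteness is derived from the volumes of boxes, then packed with [leb] so that Tonelli
    accepts it. *)
Let leb_sigma_finite := isSigmaFinite.Build _ _ _ _
  (is_lebesgue_sigma_finite lebP).
Let leb_sfinite := isSFinite.Build _ _ _ _
  (sfinite_measure_sigma_finite (is_lebesgue_sigma_finite lebP)).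
Let lebS := HB.pack_for {sigma_finite_measure set Rd -> \bar R}
  (Measure.sort leb) leb_sfinite leb_sigma_finite.

(** This makes [econv m f] the density of the image of [m \x nu] under addition. Tonelli puts the
    integral in [y] inside, translation invariance substitutes [v = y - x], and the density of [nu]
    turns the result into the measure of a section. *)
Lemma integral_econv (A : set Rd) : measurable A ->
  \int[leb]_(y in A) econv m f y =
  (m \x nu) [set z | A (tadd z.1 z.2)].
Proof.
move=> mA.
pose h (z : Rd * Rd) := ((\1_A z.2)%:E * (f (tsub z.2 z.1))%:E).
have mh : measurable_fun setT h.
  apply: emeasurable_funM => //; apply/measurable_EFinP.
  by apply: measurableT_comp => //; exact: measurable_indic.
have h0 z : 0 <= h z by rewrite mule_ge0// lee_fin.
rewrite integral_mkcond.
transitivity (\int[lebS]_y \int[m]_x h (x, y)).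
  apply: eq_integral => y _; rewrite patchE /h/=.
  rewrite indicE; case: ifPn => yA /=.
    by under eq_integral do rewrite mul1e.
  by under eq_integral do rewrite mul0e; rewrite integral0.
rewrite -(fubini_tonelli h)//.
rewrite /product_measure1; apply: eq_integral => x _ /=.
pose g v := ((\1_A (tadd v x))%:E * (f v)%:E).
have mt : measurable_fun setT ((@tadd R d)^~ x).
  exact: (measurableT_comp measurable_tadd (pair2_measurable x)).
have mg : measurable_fun setT g.
  apply: emeasurable_funM; apply/measurable_EFinP => //.
  by apply: measurableT_comp => //; exact: measurable_indic.
have g0 v : 0 <= g v by rewrite mule_ge0// lee_fin.
transitivity (\int[leb]_y g (tsub y x)).
  by apply: eq_integral => y _; rewrite /h /g tsubK.
rewrite (ge0_integral_translation lebP)//.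
have mB : measurable [set v | A (tadd v x)].
  by rewrite -[X in measurable X]setTI; apply: mt.
have -> : xsection [set z | A (tadd z.1 z.2)] x = [set v | A (tadd v x)].
  by apply/seteqP; split=> v; rewrite /xsection/= inE/= taddC.
case: nuf => _ _ ->//; rewrite [RHS]integral_mkcond.
apply: eq_integral => v _; rewrite patchE /g indicE.
have -> : (tadd v x \in A) = (v \in [set v | A (tadd v x)]).
  by apply/idP/idP; rewrite !inE.
by case: ifPn => _; rewrite ?mul1e ?mul0e.
Qed.

Lemma integral_econv_lty : \int[leb]_y econv m f y < +oo.
Proof.
rewrite integral_econv// (_ : [set z | _] = setT `*` setT); last first.
  by apply/seteqP; split.
rewrite product_measure1E// [X in _ * X]probability_setT mule1.
by rewrite ltey_eq fin_num_measure.
Qed.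

Lemma integrable_econv : leb.-integrable setT (econv m f).
Proof.
apply/integrableP; split; first exact: measurable_econv.
under eq_integral do rewrite gee0_abs ?econv_ge0//.
exact: integral_econv_lty.
Qed.

Lemma econv_fin_num : {ae leb, forall y, econv m f y \is a fin_num}.
Proof.
by have := integrable_ae measurableT integrable_econv; apply: filterS => y /(_ I).
Qed.

End finite_measure.
End convolution.

(** * Bernstein weights in a sine coordinate *)

Section sine.
Context {R : realType}.
Implicit Types x y t s L : R.

(** With [c] the cosine, the duplication formula for [2 pi / 3 = pi - pi / 3] gives
    [(2 c - 1) (c + 1) = 0], and [c] is positive. *)
Lemma cos_pi3 : cos (pi / 3 : R) = 2^-1.
Proof.
have p0 := pi_gt0 R; set c := cos (pi / 3).
have c0 : 0 < c by apply: cos_gt0_pihalf; lra.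
have : cos (pi / 3 + pi / 3 : R) = - c.
  rewrite (_ : pi / 3 + pi / 3 = pi - pi / 3); last by field.
  by rewrite cosB cospi sinpi mulN1r mul0r addr0.
rewrite cosD -!expr2 sin2cos2 -/c => c2.
have : (2 * c - 1) * (c + 1) = 0 by move: c2; nra.
by move=> /eqP; rewrite mulf_eq0 => /orP[/eqP|/eqP]; lra.
Qed.

Lemma cos_ge_half x : `|x| <= pi / 3 -> 2^-1 <= cos x.
Proof.
move=> x3; have p0 := pi_gt0 R.
have -> : cos x = cos `|x| by case: (ger0P x) => // _; rewrite cosN.
have [->|xn] := eqVneq `|x| (pi / 3); first by rewrite cos_pi3.
rewrite -cos_pi3; apply: ltW; rewrite ltr_cos ?in_itv/=.
- by rewrite lt_neqAle xn.
- by have := normr_ge0 x => ?; apply/andP; split; lra.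
- by have := normr_ge0 x => ?; apply/andP; split; lra.
Qed.

Lemma sin_ge_half x : 0 <= x <= pi / 3 -> x / 2 <= sin x.
Proof.
move=> /andP[x0 x3].
have [c] := @MVT_segment R sin cos 0 x x0 (fun y _ => is_derive_sin y)
  (continuous_subspaceT (@continuous_sin R)).
rewrite in_itv/= sin0 !subr0 => /andP[c0 cx] ->.
rewrite mulrC ler_wpM2r//; apply: cos_ge_half.
by rewrite ger0_norm// (le_trans cx).
Qed.

Lemma norm_sin_ge_half x : `|x| <= pi / 3 -> `|x| / 2 <= `|sin x|.
Proof.
move=> x3; have -> : `|sin x| = `|sin `|x| |.
  by case: (ger0P x) => // _; rewrite sinN normrN.
apply: le_trans (ler_norm _); apply: sin_ge_half.
by rewrite normr_ge0.
Qed.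

(** Write the difference as [2 sin a cos b] with [a] and [b] the half difference and half sum. The
    unequal bounds [pi / 2] and [pi / 6] add up so that both stay within [pi / 3], where the sine is
    at least half its argument in absolute value and the cosine at least one half. *)
Lemma norm_sinB_ge x y : `|x| <= pi / 2 -> `|y| <= pi / 6 ->
  `|x - y| / 4 <= `|sin x - sin y|.
Proof.
rewrite !ler_norml => /andP[x1 x2] /andP[y1 y2].
pose a := (x - y) / 2; pose b := (x + y) / 2.
have -> : sin x - sin y = 2 * sin a * cos b.
  have -> : x = b + a by rewrite /a /b; field.
  have -> : y = b - a by rewrite /a /b; field.
  by rewrite sinD sinB; ring.
have a3 : `|a| <= pi / 3 by rewrite ler_norml /a; apply/andP; split; lra.
have b3 : `|b| <= pi / 3 by rewrite ler_norml /b; apply/andP; split; lra.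
have sa := norm_sin_ge_half a3; have cb := cos_ge_half b3.
have -> : `|x - y| = 2 * `|a|.
  by rewrite /a normrM [X in _ * (_ * X)]ger0_norm ?invr_ge0//; field.
have -> : `|2 * sin a * cos b| = 2 * `|sin a| * cos b.
  rewrite normrM normrM (ger0_norm (_ : 0 <= 2))// (ger0_norm (_ : 0 <= cos b))//.
  by apply: le_trans cb; lra.
have : 0 <= `|sin a| * (cos b - 2^-1) by rewrite mulr_ge0// subr_ge0.
by move: sa; rewrite mulrBr; move: (`|a|) => ? ? ?; lra.
Qed.

(** It increases from 0 to 1 on [[-L, L]] and has period [4 L]; being trigonometric in [t], it keeps
    polynomials in it trigonometric. *)
Definition sine_coord L t := (1 + sin (pi / (2 * L) * t)) / 2.

(** The point of [[-L, L]] whose sine coordinate is [j / N]. *)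
Definition sine_node L (N j : nat) := 2 * L / pi * asin (2 * j%:R / N%:R - 1).

Lemma sine_coord_itv L t : 0 <= sine_coord L t <= 1.
Proof.
rewrite /sine_coord; have := sin_geN1 (pi / (2 * L) * t).
by have := sin_le1 (pi / (2 * L) * t); lra.
Qed.

Let node_arg (N j : nat) : (0 < N)%N -> (j <= N)%N ->
  -1 <= (2 * j%:R / N%:R - 1 : R) <= 1.
Proof.
move=> N0 jN; have jN0 : 0 <= j%:R / N%:R :> R by rewrite divr_ge0.
have : j%:R / N%:R <= 1 :> R by rewrite ler_pdivrMr ?ltr0n// mul1r ler_nat.
by rewrite -mulrA; lra.
Qed.

Lemma sine_coord_node L (N j : nat) : 0 < L -> (0 < N)%N -> (j <= N)%N ->
  sine_coord L (sine_node L N j) = j%:R / N%:R.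
Proof.
move=> L0 N0 jN; have p0 := pi_gt0 R; rewrite /sine_coord /sine_node.
rewrite (_ : _ / _ * _ = asin (2 * j%:R / N%:R - 1)); last first.
  by move: (@pi R) p0 (asin _) => p p0 a; field; rewrite !gt_eqF.
rewrite asinK; last by rewrite in_itv/= node_arg.
by field; rewrite pnatr_eq0 -lt0n.
Qed.

Lemma norm_sine_node_le L (N j : nat) : 0 < L -> (0 < N)%N -> (j <= N)%N ->
  `|sine_node L N j| <= L.
Proof.
move=> L0 N0 jN; have p0 := pi_gt0 R; rewrite /sine_node normrM.
have a2 : `|asin (2 * j%:R / N%:R - 1 : R)| <= pi / 2.
  by rewrite ler_norml asin_geNpi2 ?asin_lepi2// node_arg.
rewrite ger0_norm; last by rewrite divr_ge0//; lra.
apply: (@le_trans _ _ (2 * L / pi * (pi / 2))).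
  by rewrite ler_wpM2l// divr_ge0//; lra.
by move: (@pi R) p0 => p ?; rewrite le_eqVlt; apply/orP; left; apply/eqP; field;
  rewrite gt_eqF.
Qed.

(** A quantitative injectivity: nodes [s] range over [[-L, L]] while the evaluation point [t] stays
    in the middle third. The slope [pi / (2 L)] is at least [1 / L], and the factor 8 collects the 4
    of [norm_sinB_ge] and the 2 of [sine_coord]. *)
Lemma norm_sine_coordB_ge L s t : 0 < L -> `|s| <= L -> `|t| <= L / 3 ->
  `|s - t| / (8 * L) <= `|sine_coord L s - sine_coord L t|.
Proof.
move=> L0 sL tL; have p0 := pi_gt0 R; have p2 := pi_ge2 R.
set k := pi / (2 * L); have k0 : 0 < k by rewrite divr_gt0//; lra.
have kL : k * L = pi / 2 by rewrite /k; move: (@pi R) => p; field; rewrite gt_eqF.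
have ks : `|k * s| <= pi / 2 by rewrite normrM gtr0_norm// -kL ler_pM2l.
have kt : `|k * t| <= pi / 6.
  rewrite normrM gtr0_norm// (_ : pi / 6 = k * (L / 3)) ?ler_pM2l//.
  by rewrite mulrA kL; field.
have := norm_sinB_ge ks kt; rewrite -mulrBr normrM (gtr0_norm k0).
rewrite /sine_coord -/k (_ : (1 + sin (k * s)) / 2 - (1 + sin (k * t)) / 2
   = (sin (k * s) - sin (k * t)) / 2); last by field.
rewrite [X in _ -> _ <= X]normrM [X in _ -> _ <= _ * X]ger0_norm ?invr_ge0// => H.
apply: (@le_trans _ _ (k * `|s - t| / 4 / 2)); last by rewrite ler_pM2r// invr_gt0.
have st := normr_ge0 (s - t).
have -> : `|s - t| / (8 * L) = (2 / (2 * L)) * `|s - t| / 8 by field; rewrite gt_eqF.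
rewrite -[X in _ <= X]mulrA -invfM (_ : 4 * 2 = 8); last by ring.
rewrite ler_pM2r ?invr_gt0// ler_wpM2r// /k ler_pM2r// invr_gt0; lra.
Qed.

End sine.

(** * Binomial weights and their first two moments *)

Section bernstein.
Context {R : realType}.

(* [bernstein n k u] is the probability that a binomial variable with
   parameters [n] and [u] equals [k], given by Pascal's recursion. *)
Fixpoint bernstein (n k : nat) (u : R) : R :=
  if n is n'.+1 then
    (1 - u) * bernstein n' k u + (if k is k'.+1 then u * bernstein n' k' u else 0)
  else (k == 0)%:R.

Lemma bernstein_ge0 n k u : 0 <= u <= 1 -> 0 <= bernstein n k u.
Proof.
move=> /andP[u0 u1]; elim: n k => [|n IH] k /=; first exact: ler0n.
apply: addr_ge0; first by rewrite mulr_ge0// subr_ge0.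
by case: k => // k; rewrite mulr_ge0.
Qed.

Lemma bernstein_small n k u : (n < k)%N -> bernstein n k u = 0.
Proof.
elim: n k => [|n IH] [|k]//= nk.
by rewrite !IH ?mulr0 ?addr0// ltnW.
Qed.

(** Condition on the last trial: a failure leaves the count unchanged, a success shifts it by one.
    The moments then follow by induction on [n]. *)
Lemma bernstein_sumS n u (phi : nat -> R) :
  \sum_(k < n.+2) bernstein n.+1 k u * phi k =
  (1 - u) * (\sum_(k < n.+1) bernstein n k u * phi k) +
  u * (\sum_(k < n.+1) bernstein n k u * phi k.+1).
Proof.
transitivity (\sum_(k < n.+2) (1 - u) * (bernstein n k u * phi k) +
  \sum_(k < n.+2) (if k : nat is k'.+1 then u * bernstein n k' u else 0) * phi k).
  by rewrite -big_split; apply: eq_bigr => k _ /=; rewrite mulrDl !mulrA.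
rewrite -mulr_sumr big_ord_recr/= bernstein_small// mul0r addr0; congr (_ + _).
rewrite big_ord_recl/= mul0r add0r mulr_sumr.
by apply: eq_bigr => k _; rewrite /bump/= add1n mulrA.
Qed.

Lemma bernstein_sum n u : \sum_(k < n.+1) bernstein n k u = 1.
Proof.
under eq_bigr do rewrite -[bernstein _ _ _]mulr1.
elim: n => [|n IH]; first by rewrite big_ord1 mulr1.
by rewrite (bernstein_sumS n u (fun=> 1)) IH; ring.
Qed.

Lemma bernstein_sum1 n u : \sum_(k < n.+1) bernstein n k u * k%:R = n%:R * u.
Proof.
elim: n => [|n IH]; first by rewrite big_ord1 mulr0 mul0r.
rewrite (bernstein_sumS n u (fun k => k%:R)) IH.
under eq_bigr do rewrite -natr1 mulrDr mulr1.
by rewrite big_split/= IH bernstein_sum -natr1; ring.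
Qed.

Lemma bernstein_sum2 n u :
  \sum_(k < n.+1) bernstein n k u * k%:R ^+ 2 =
  n%:R * u * (1 - u) + (n%:R * u) ^+ 2.
Proof.
elim: n => [|n IH]; first by rewrite big_ord1 expr0n mulr0 !mul0r expr0n addr0.
rewrite (bernstein_sumS n u (fun k => k%:R ^+ 2)) IH.
have -> : \sum_(k < n.+1) bernstein n k u * k.+1%:R ^+ 2 =
    \sum_(k < n.+1) bernstein n k u * k%:R ^+ 2 +
    2 * (\sum_(k < n.+1) bernstein n k u * k%:R) +
    \sum_(k < n.+1) bernstein n k u.
  rewrite mulr_sumr -!big_split; apply: eq_bigr => k _ /=.
  by rewrite -natr1; ring.
rewrite IH bernstein_sum1 bernstein_sum.
by rewrite -natr1; ring.
Qed.

(** Expanding the square and inserting the moments gives [u (1 - u) / n], bounded crudely. *)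
Lemma bernstein_variance n u : (0 < n)%N -> 0 <= u <= 1 ->
  \sum_(k < n.+1) bernstein n k u * (k%:R / n%:R - u) ^+ 2 <= n%:R^-1.
Proof.
move=> n0 u01; have n0' : n%:R != 0 :> R by rewrite pnatr_eq0 -lt0n.
rewrite [leLHS](_ : _ = u * (1 - u) / n%:R); last first.
  transitivity (n%:R ^- 2 * (\sum_(k < n.+1) bernstein n k u * k%:R ^+ 2)
    - 2 * u / n%:R * (\sum_(k < n.+1) bernstein n k u * k%:R)
    + u ^+ 2 * \sum_(k < n.+1) bernstein n k u).
    rewrite !mulr_sumr -sumrB -big_split; apply: eq_bigr => k _ /=.
    by field.
  rewrite bernstein_sum bernstein_sum1 bernstein_sum2; by field.
rewrite ler_piMl ?invr_ge0//; nra.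
Qed.

End bernstein.

(** * Approximation by trigonometric polynomials *)

Section bernstein_approximation.
Context {R : realType} {d : nat}.
Local Notation Rd := (d.-tuple R).
Implicit Types (h : Rd -> R) (x : Rd).

(** Phrased like the first clause of [C0fun], so that real and imaginary parts inherit it
    directly. *)
Definition tcontinuous h := forall x (e : R), 0 < e ->
  exists2 delta : R, 0 < delta &
    forall y, tnorm (tsub y x) < delta -> `|h y - h x| < e.

Definition grid L N (k : {ffun 'I_d -> 'I_N.+1}) : Rd :=
  [tuple sine_node L N (k i) | i < d].

(** The probability that independent binomial variables with parameters [N] and
    [sine_coord L (tnth x i)] take the values [k i]; [bapprox] is the resulting expectation of [h]
    at a random grid point. *)
Definition grid_weight L N (k : {ffun 'I_d -> 'I_N.+1}) x : R :=
  \prod_(i < d) bernstein N (k i) (sine_coord L (tnth x i)).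

Definition bapprox L N h x : R :=
  \sum_(k : {ffun 'I_d -> 'I_N.+1}) h (grid L k) * grid_weight L k x.

Lemma grid_weight_ge0 L N (k : {ffun 'I_d -> 'I_N.+1}) x :
  0 <= grid_weight L k x.
Proof.
by apply: prodr_ge0 => i _; apply: bernstein_ge0; exact: sine_coord_itv.
Qed.

Lemma sum_grid_weight L N x :
  \sum_(k : {ffun 'I_d -> 'I_N.+1}) grid_weight L k x = 1.
Proof.
rewrite -(bigA_distr_bigA (fun i (j : 'I_N.+1) =>
  bernstein N j (sine_coord L (tnth x i)))).
by rewrite big1// => i _; rewrite bernstein_sum.
Qed.

(** The squared deviation is absorbed into the factor of coordinate [i]. The sum over [k] then
    factorises: the other coordinates contribute 1, and coordinate [i] its binomial variance. *)
Lemma grid_weight_variance L N x (i : 'I_d) : (0 < N)%N ->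
  \sum_(k : {ffun 'I_d -> 'I_N.+1})
    grid_weight L k x * ((k i)%:R / N%:R - sine_coord L (tnth x i)) ^+ 2
  <= N%:R^-1.
Proof.
move=> N0.
pose u := sine_coord L (tnth x i).
pose F (j : 'I_d) (m : 'I_N.+1) := bernstein N m (sine_coord L (tnth x j)) *
  (if j == i then (m%:R / N%:R - u) ^+ 2 else 1).
rewrite (eq_bigr (fun k : {ffun 'I_d -> 'I_N.+1} => \prod_j F j (k j))); last first.
  move=> k _; rewrite /F big_split/=; congr (_ * _).
  by rewrite -big_mkcond big_pred1_eq.
rewrite -bigA_distr_bigA (bigD1 i)//= [X in _ * X]big1 ?mulr1; last first.
  move=> j ji; rewrite /F (negbTE ji).
  by under eq_bigr do rewrite mulr1; rewrite bernstein_sum.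
rewrite /F; under eq_bigr do rewrite eqxx.
by apply: bernstein_variance => //; exact: sine_coord_itv.
Qed.

Lemma norm_bapprox_le L N h x M : (forall y, `|h y| <= M) ->
  `|bapprox L N h x| <= M.
Proof.
move=> hM; rewrite (le_trans (ler_norm_sum _ _ _))//.
rewrite -[leRHS]mulr1 -(sum_grid_weight L N x) mulr_sumr ler_sum// => k _.
by rewrite normrM (ger0_norm (grid_weight_ge0 _ _ _)) ler_wpM2r// grid_weight_ge0.
Qed.

(** Chebyshev's argument. At a node within [delta] of [x] the error is at most [e]. Otherwise some
    coordinate is off by [delta], so by [norm_sine_coordB_ge] the quantity [K * V k i] is at least 1
    and dominates the trivial bound [2 M]. Averaging over the nodes replaces each [V k i] by at most
    [1 / N]. *)
Lemma bapprox_error L N h x (M e delta : R) : 0 < L -> (0 < N)%N ->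
  (forall y, `|h y| <= M) -> (forall i, `|tnth x i| <= L / 3) ->
  0 < delta -> 0 <= e ->
  (forall y, tnorm (tsub y x) < delta -> `|h y - h x| <= e) ->
  `|bapprox L N h x - h x| <= e + 2 * M * d%:R * (8 * L / delta) ^+ 2 / N%:R.
Proof.
move=> L0 N0 hM xL delta0 e0 hx.
have M0 : 0 <= M by exact: le_trans (hM x).
pose K := (8 * L / delta) ^+ 2.
pose V (k : {ffun 'I_d -> 'I_N.+1}) i :=
  ((k i)%:R / N%:R - sine_coord L (tnth x i)) ^+ 2.
have V0 k i : 0 <= V k i by exact: sqr_ge0.
have K0 : 0 <= K by exact: sqr_ge0.
have -> : bapprox L N h x - h x =
    \sum_(k : {ffun 'I_d -> 'I_N.+1}) (h (grid L k) - h x) * grid_weight L k x.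
  rewrite -[X in _ - X]mulr1 -(sum_grid_weight L N x) mulr_sumr -sumrB.
  by apply: eq_bigr => k _; rewrite mulrBl.
have key (k : {ffun 'I_d -> 'I_N.+1}) :
    `|h (grid L k) - h x| <= e + 2 * M * K * \sum_i V k i.
  have [hk|hk] := ltP (tnorm (tsub (grid L k) x)) delta.
    rewrite (le_trans (hx _ hk))// lerDl.
    by rewrite mulr_ge0 ?sumr_ge0// mulr_ge0// mulr_ge0.
  have [i hi] : exists i, delta <= `|tnth (tsub (grid L k) x) i|.
    apply: contrapT => /forallNP H.
    have : tnorm (tsub (grid L k) x) < delta.
      by apply/(tnorm_ltP _ delta0) => i; rewrite ltNge; apply/negP/H.
    by rewrite ltNge hk.
  apply: (@le_trans _ _ (2 * M)).
    by rewrite (le_trans (ler_normB _ _))// mulr2n mulrDl mul1r lerD.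
  rewrite -[leLHS]add0r lerD// -[leLHS]mulr1 -[leRHS]mulrA ler_wpM2l//.
    by rewrite mulr_ge0.
  apply: (@le_trans _ _ (K * V k i)); last first.
    by rewrite ler_wpM2l// (bigD1 i)//= lerDl sumr_ge0.
  rewrite /K /V -exprMn -real_normK ?num_real// exprn_ege1//.
  rewrite normrM ger0_norm; last by rewrite divr_ge0// ?mulr_ge0// ltW.
  have kN : (k i <= N)%N by rewrite -ltnS.
  rewrite -(sine_coord_node L0 N0 kN).
  apply: le_trans (ler_wpM2l _ (norm_sine_coordB_ge L0
    (norm_sine_node_le L0 N0 kN) (xL i))); last first.
    by rewrite divr_ge0// ?mulr_ge0// ltW.
  move: hi; rewrite !tnth_mktuple => hi.
  rewrite -[X in X <= _](@divff _ (delta * (8 * L))); last first.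
    by rewrite mulf_neq0// ?mulf_neq0// gt_eqF.
  rewrite mulf_div [X in _ <= X / _]mulrC ler_pM2r; last first.
    by rewrite invr_gt0 mulr_gt0// mulr_gt0.
  by rewrite ler_pM2r// mulr_gt0.
rewrite (le_trans (ler_norm_sum _ _ _))//.
apply: (@le_trans _ _ (\sum_(k : {ffun 'I_d -> 'I_N.+1})
    (e * grid_weight L k x + 2 * M * K * \sum_i (grid_weight L k x * V k i)))).
  apply: ler_sum => k _; rewrite normrM (ger0_norm (grid_weight_ge0 _ _ _)).
  apply: le_trans (ler_wpM2r (grid_weight_ge0 _ _ _) (key k)) _.
  rewrite mulrDl -[X in _ + X <= _]mulrA mulr_suml.
  by under [in leRHS]eq_bigr do rewrite mulrC.
rewrite big_split/= -!mulr_sumr sum_grid_weight mulr1 lerD2l exchange_big/=.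
have -> : 2 * M * d%:R * (8 * L / delta) ^+ 2 / N%:R =
    2 * M * K * \sum_(i < d) N%:R^-1.
  by rewrite sumr_const card_ord -mulr_natl -/K; ring.
apply: ler_wpM2l; first by rewrite mulr_ge0// mulr_ge0.
by apply: ler_sum => i _; exact: grid_weight_variance.
Qed.

Lemma bapprox_cvg h M : (forall y, `|h y| <= M) -> tcontinuous h ->
  forall x, (fun n => bapprox n.+1%:R (n.+1 ^ 3) h x) @ \oo --> h x.
Proof.
move=> hM hc x; apply/cvgrPdist_lt => e e0.
have [delta delta0 hx] := hc x (e / 2) ltac:(by rewrite divr_gt0).
have M0 : 0 <= M by exact: le_trans (hM x).
pose B := 2 * M * d%:R * (8 / delta) ^+ 2.
have B0 : 0 <= B by rewrite !mulr_ge0// ?invr_ge0 ltW.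
(* [n0] places [x] in the middle third of [[-L, L]]. With [N = L ^ 3] the error term is [B / L], and
   [n1] brings it below [e / 2]. *)
pose n0 := Num.bound (3 * tnorm x); pose n1 := Num.bound (2 * B / e).
have t0 := tnorm_ge0 x.
exists (maxn n0 n1) => // n /=; rewrite geq_max => /andP[n0n n1n].
set L : R := n.+1%:R; have L0 : 0 < L by rewrite ltr0n.
have xL i : `|tnth x i| <= L / 3.
  rewrite ler_pdivlMr// mulrC.
  apply: (@le_trans _ _ (3 * tnorm x)).
    by rewrite ler_pM2l//; exact: (tnorm_leP _ t0 _).
  have /archi_boundP/ltW/le_trans : 0 <= 3 * tnorm x by rewrite mulr_ge0.
  by apply; rewrite ler_nat leqW.
rewrite distrC.
have N0 : (0 < n.+1 ^ 3)%N by rewrite expn_gt0.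
have e2 : 0 <= e / 2 by rewrite divr_ge0// ltW.
apply: le_lt_trans (bapprox_error L0 N0 hM xL delta0 e2
  (fun y H => ltW (hx y H))) _.
have -> : 2 * M * d%:R * (8 * L / delta) ^+ 2 / (n.+1 ^ 3)%:R = B / L.
  by rewrite natrX -/L /B; field; rewrite !gt_eqF.
have : B / L < e / 2.
  have /archi_boundP/lt_le_trans : 0 <= 2 * B / e.
    by apply: divr_ge0; [apply: mulr_ge0|exact: ltW].
  move=> /(_ L); rewrite ler_nat => /(_ (leqW n1n)).
  by rewrite ltr_pdivrMr// ltr_pdivrMr// => ?; lra.
by move: (B / L) => ? ?; lra.
Qed.

End bernstein_approximation.

(** * The algebra of real trigonometric polynomials *)

Section trigonometric_polynomials.
Context {R : realType} {d : nat}.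
Local Notation Rd := (d.-tuple R).

(** The constructors are those operations through which equality of integrals passes; stability
    under products is derived afterwards. *)
Inductive trigpoly : (Rd -> R) -> Prop :=
| trigpoly_cos w : trigpoly (fun x => cos (tdot w x))
| trigpoly_sin w : trigpoly (fun x => sin (tdot w x))
| trigpolyD f g : trigpoly f -> trigpoly g -> trigpoly (fun x => f x + g x)
| trigpolyZ c f : trigpoly f -> trigpoly (fun x => c * f x).

Lemma trigpoly_ext f g : f =1 g -> trigpoly f -> trigpoly g.
Proof. by move=> /funext ->. Qed.

Lemma tdot0l (x : Rd) : tdot (cst_tuple 0) x = 0.
Proof. by rewrite /tdot big1// => i _; rewrite tnth_mktuple mul0r. Qed.

Lemma trigpoly_cst c : trigpoly (fun=> c).
Proof.
apply: trigpoly_ext (trigpolyZ c (trigpoly_cos (cst_tuple 0))) => x.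
by rewrite tdot0l cos0 mulr1.
Qed.

Lemma trigpoly_sum (I : Type) (r : seq I) (F : I -> Rd -> R) :
  (forall i, trigpoly (F i)) -> trigpoly (fun x => \sum_(i <- r) F i x).
Proof.
move=> tF; elim: r => [|i r IH].
  by apply: trigpoly_ext (trigpoly_cst 0) => x; rewrite big_nil.
by apply: trigpoly_ext (trigpolyD (tF i) IH) => x; rewrite big_cons.
Qed.

(** Product-to-sum formulas handle the generators, with frequencies [w + v] and [w - v]; the linear
    cases go by induction. *)
Let trigpolyM_cos w g : trigpoly g -> trigpoly (fun x => cos (tdot w x) * g x).
Proof.
move=> tg; elim: tg => {g} [v|v|f g _ tf _ tg|c f _ tf].
- apply: trigpoly_ext (trigpolyZ 2^-1 (trigpolyD (trigpoly_cos (tadd w v))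
    (trigpoly_cos (tsub w v)))) => x.
  by rewrite tdotDl tdotBl cosB cosD; field.
- apply: trigpoly_ext (trigpolyZ 2^-1 (trigpolyD (trigpoly_sin (tadd w v))
    (trigpolyZ (-1) (trigpoly_sin (tsub w v))))) => x.
  by rewrite tdotDl tdotBl sinB sinD; field.
- by apply: trigpoly_ext (trigpolyD tf tg) => x; rewrite mulrDr.
- by apply: trigpoly_ext (trigpolyZ c tf) => x; rewrite mulrCA.
Qed.

Let trigpolyM_sin w g : trigpoly g -> trigpoly (fun x => sin (tdot w x) * g x).
Proof.
move=> tg; elim: tg => {g} [v|v|f g _ tf _ tg|c f _ tf].
- apply: trigpoly_ext (trigpolyZ 2^-1 (trigpolyD (trigpoly_sin (tadd w v))
    (trigpoly_sin (tsub w v)))) => x.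
  by rewrite tdotDl tdotBl sinB sinD; field.
- apply: trigpoly_ext (trigpolyZ 2^-1 (trigpolyD (trigpoly_cos (tsub w v))
    (trigpolyZ (-1) (trigpoly_cos (tadd w v))))) => x.
  by rewrite tdotDl tdotBl cosB cosD; field.
- by apply: trigpoly_ext (trigpolyD tf tg) => x; rewrite mulrDr.
- by apply: trigpoly_ext (trigpolyZ c tf) => x; rewrite mulrCA.
Qed.

Lemma trigpolyM f g : trigpoly f -> trigpoly g -> trigpoly (fun x => f x * g x).
Proof.
move=> tf tg; elim: tf => {f} [v|v|f h _ tf _ th|c f _ tf].
- exact: trigpolyM_cos.
- exact: trigpolyM_sin.
- by apply: trigpoly_ext (trigpolyD tf th) => x; rewrite mulrDl.
- by apply: trigpoly_ext (trigpolyZ c tf) => x; rewrite mulrA.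
Qed.

Lemma trigpoly_prod (I : Type) (r : seq I) (F : I -> Rd -> R) :
  (forall i, trigpoly (F i)) -> trigpoly (fun x => \prod_(i <- r) F i x).
Proof.
move=> tF; elim: r => [|i r IH].
  by apply: trigpoly_ext (trigpoly_cst 1) => x; rewrite big_nil.
by apply: trigpoly_ext (trigpolyM (tF i) IH) => x; rewrite big_cons.
Qed.

Lemma trigpoly_sine_coord L (i : 'I_d) :
  trigpoly (fun x => sine_coord L (tnth x i)).
Proof.
pose w : Rd := [tuple (if j == i then pi / (2 * L) else 0) | j < d].
apply: trigpoly_ext (trigpolyD (trigpoly_cst 2^-1)
  (trigpolyZ 2^-1 (trigpoly_sin w))) => x.
rewrite /sine_coord (_ : tdot w x = pi / (2 * L) * tnth x i); first by field.
rewrite /tdot (bigD1 i)//= tnth_mktuple eqxx big1 ?addr0// => j ji.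
by rewrite tnth_mktuple (negbTE ji) mul0r.
Qed.

Lemma trigpoly_bernstein n k u :
  trigpoly u -> trigpoly (fun x => bernstein n k (u x)).
Proof.
move=> tu; elim: n k => [|n IH] k /=; first exact: trigpoly_cst.
apply: trigpolyD.
  apply: trigpolyM => //; apply: trigpolyD; first exact: trigpoly_cst.
  by apply: trigpoly_ext (trigpolyZ (-1) tu) => x; rewrite mulN1r.
by case: k => [|k]; [exact: trigpoly_cst|exact: trigpolyM].
Qed.

Lemma trigpoly_bapprox L N h : trigpoly (bapprox L N h).
Proof.
apply: trigpoly_sum => k; apply: trigpolyZ; apply: trigpoly_prod => i.
by apply: trigpoly_bernstein; exact: trigpoly_sine_coord.
Qed.

Lemma measurable_trigpoly f : trigpoly f -> measurable_fun setT f.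
Proof.
elim=> {f} [w|w|f g _ mf _ mg|c f _ mf].
- apply: measurableT_comp; last exact: measurable_tdot.
  exact: continuous_measurable_fun (@continuous_cos R).
- apply: measurableT_comp; last exact: measurable_tdot.
  exact: continuous_measurable_fun (@continuous_sin R).
- exact: measurable_funD.
- exact: measurable_funM.
Qed.

Lemma bounded_trigpoly f : trigpoly f -> exists M, forall x, `|f x| <= M.
Proof.
elim=> {f} [w|w|f g _ [M fM] _ [N gN]|c f _ [M fM]].
- by exists 1 => x; rewrite ler_norml cos_geN1 cos_le1.
- by exists 1 => x; rewrite ler_norml sin_geN1 sin_le1.
- by exists (M + N) => x; rewrite (le_trans (ler_normD _ _))// lerD.
- by exists (`|c| * M) => x; rewrite normrM ler_wpM2l.
Qed.

End trigonometric_polynomials.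

(** * Characteristic functions and deconvolution *)

Section bounded_integrals.
Context {dT} {T : measurableType dT} {R : realType}.
Variable m : {measure set T -> \bar R}.
Hypothesis moo : (m setT < +oo)%E.

Lemma bounded_integrable (f : T -> R) M : measurable_fun setT f ->
  (forall x, `|f x| <= M) -> m.-integrable setT (EFin \o f).
Proof.
move=> mf fM; apply: measurable_bounded_integrable => //.
exists M; split; first exact: num_real.
by move=> N MN x _ /=; rewrite (le_trans (fM x))// ltW.
Qed.

Lemma EFin_Rintegral (f : T -> R) : m.-integrable setT (EFin \o f) ->
  (\int[m]_x f x)%:E = (\int[m]_x (f x)%:E)%E.
Proof. by move=> fi; rewrite /Rintegral fineK//; exact: integrable_fin_num. Qed.

Lemma bounded_Rintegral_cvg (f_ : (T -> R)^nat) (f : T -> R) M :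
  (forall n, measurable_fun setT (f_ n)) -> (forall n x, `|f_ n x| <= M) ->
  (forall x, f_ ^~ x @ \oo --> f x) ->
  (fun n => \int[m]_x f_ n x) @ \oo --> \int[m]_x f x.
Proof.
move=> mf_ fM ff; have mf : measurable_fun setT f.
  by apply: (measurable_fun_cvg mf_) => x _; exact: ff.
have Mi : m.-integrable setT (EFin \o cst M).
  by apply: (@bounded_integrable _ `|M|).
have [] := @dominated_convergence _ _ _ m setT measurableT
  (fun n => EFin \o f_ n) (EFin \o f) (EFin \o cst M).
- by move=> n; exact/measurable_EFinP.
- exact/measurable_EFinP.
- by apply: aeW => x _; apply: cvg_EFin; [exact: nearW|exact: ff].
- exact: Mi.
- by apply: aeW => x n _ /=; rewrite lee_fin.
move=> fi _ H.
have : (fun n => (\int[m]_x f_ n x)%:E) @ \oo --> (\int[m]_x f x)%:E.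
  rewrite (EFin_Rintegral fi).
  rewrite (_ : (fun n => _) = (fun n => \int[m]_x (f_ n x)%:E)%E)//.
  by apply/funext => n; rewrite /= EFin_Rintegral//; exact: bounded_integrable (fM n).
by move=> /fine_cvg.
Qed.

End bounded_integrals.

Section characteristic_functions.
Context {R : realType} {d : nat}.
Local Notation Rd := (d.-tuple R).

(** Measurability is read off the approximation: [h] is the pointwise limit of trigonometric
    polynomials. *)
Lemma tcontinuous_measurable (h : Rd -> R) M :
  (forall x, `|h x| <= M) -> tcontinuous h -> measurable_fun setT h.
Proof.
move=> hM hc; apply: (@measurable_fun_cvg _ _ _ _
  (fun n => bapprox n.+1%:R (n.+1 ^ 3) h)) => [n|x _];
  last exact: bapprox_cvg hM hc x.
exact: measurable_trigpoly (trigpoly_bapprox _ _ _).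
Qed.

Let finite_lty (p : {finite_measure set Rd -> \bar R}) : (p setT < +oo)%E.
Proof. by rewrite ltey_eq fin_num_measure. Qed.

(** [cosint] and [sinint] are the real and imaginary parts of the characteristic function of [m]. *)
Definition cosint (m : {measure set Rd -> \bar R}) (w : Rd) : R :=
  \int[m]_x cos (tdot w x).
Definition sinint (m : {measure set Rd -> \bar R}) (w : Rd) : R :=
  \int[m]_x sin (tdot w x).

Lemma integrable_trigpoly (p : {finite_measure set Rd -> \bar R}) f :
  trigpoly f -> p.-integrable setT (EFin \o f).
Proof.
move=> tf; have [M fM] := bounded_trigpoly tf.
exact (bounded_integrable (finite_lty p) (measurable_trigpoly tf) fM).
Qed.

Section uniqueness.
Variables p q : {finite_measure set Rd -> \bar R}.
Hypothesis cos_pq : forall w, cosint p w = cosint q w.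
Hypothesis sin_pq : forall w, sinint p w = sinint q w.

Lemma Rintegral_trigpoly_eq f : trigpoly f -> \int[p]_x f x = \int[q]_x f x.
Proof.
elim=> {f} [w|w|f g tf fpq tg gpq|c f tf fpq].
- exact: cos_pq.
- exact: sin_pq.
- by rewrite !RintegralD ?fpq ?gpq//; exact: integrable_trigpoly.
- by rewrite !RintegralZl ?fpq//; exact: integrable_trigpoly.
Qed.

(** The approximants obey the bound [M] on the whole space and converge at every point, so dominated
    convergence applies to both measures without a tightness argument. *)
Lemma Rintegral_charfun_unique (h : Rd -> R) M :
  (forall x, `|h x| <= M) -> tcontinuous h -> \int[p]_x h x = \int[q]_x h x.
Proof.
move=> hM hc.
pose a n := bapprox n.+1%:R (n.+1 ^ 3) h.
have ma n : measurable_fun setT (a n).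
  exact: measurable_trigpoly (trigpoly_bapprox _ _ _).
have aM n x : `|a n x| <= M by exact: norm_bapprox_le.
have ah := bapprox_cvg hM hc.
have hp := bounded_Rintegral_cvg (finite_lty p) ma aM ah.
have hq := bounded_Rintegral_cvg (finite_lty q) ma aM ah.
apply: (cvg_unique _ hp) => //.
rewrite (_ : (fun n => _) = (fun n => \int[q]_x a n x))//.
by apply/funext => n; apply: Rintegral_trigpoly_eq; exact: trigpoly_bapprox.
Qed.

End uniqueness.

Lemma tdot_cvg (w_ : nat -> Rd) (w x : Rd) :
  (forall i, (fun n => tnth (w_ n) i) @ \oo --> tnth w i) ->
  (fun n => tdot (w_ n) x) @ \oo --> tdot w x.
Proof.
move=> ww; rewrite /tdot; apply: cvg_big => [|i _]; first exact: add_continuous.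
by apply: cvgM; [exact: ww|exact: cvg_cst].
Qed.

Lemma cosint_cvg (p : {finite_measure set Rd -> \bar R})
    (w_ : nat -> Rd) (w : Rd) :
  (forall i, (fun n => tnth (w_ n) i) @ \oo --> tnth w i) ->
  (fun n => cosint p (w_ n)) @ \oo --> cosint p w.
Proof.
move=> ww; apply: (@bounded_Rintegral_cvg _ _ _ _ (finite_lty p) _ _ 1) => [n|n x|x].
- exact: measurable_trigpoly (trigpoly_cos _).
- by rewrite ler_norml cos_geN1 cos_le1.
- by apply: continuous_cvg; [exact: continuous_cos|exact: tdot_cvg].
Qed.

Lemma sinint_cvg (p : {finite_measure set Rd -> \bar R})
    (w_ : nat -> Rd) (w : Rd) :
  (forall i, (fun n => tnth (w_ n) i) @ \oo --> tnth w i) ->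
  (fun n => sinint p (w_ n)) @ \oo --> sinint p w.
Proof.
move=> ww; apply: (@bounded_Rintegral_cvg _ _ _ _ (finite_lty p) _ _ 1) => [n|n x|x].
- exact: measurable_trigpoly (trigpoly_sin _).
- by rewrite ler_norml sin_geN1 sin_le1.
- by apply: continuous_cvg; [exact: continuous_sin|exact: tdot_cvg].
Qed.

(** The box with corner [w] and sides [1 / (n + 1)] has positive volume, so it is not contained in
    the exceptional null set; picking a point in each gives the sequence. *)
Lemma is_lebesgue_ae_dense (leb : {measure set Rd -> \bar R}) (Q : Rd -> Prop) :
  is_lebesgue leb -> {ae leb, forall w, Q w} ->
  forall w : Rd, exists2 w_ : nat -> Rd, forall n, Q (w_ n) &
    forall i, (fun n => tnth (w_ n) i) @ \oo --> tnth w i.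
Proof.
move=> lebP [N [mN N0 QN]] w.
have H n : exists v, box w (tadd w (cst_tuple n.+1%:R^-1)) v /\ Q v.
  apply: contrapT => /forallNP H.
  have : (leb (box w (tadd w (cst_tuple n.+1%:R^-1))) <= leb N)%E.
    apply: le_measure; rewrite ?inE//; first exact: measurable_box.
    by move=> v vb; apply: QN => /= Qv; exact: (H v).
  rewrite N0 lebP; last by move=> i; rewrite !tnth_mktuple lerDl invr_ge0.
  rewrite lee_fin leNgt prodr_gt0// => i _.
  by rewrite !tnth_mktuple addrAC subrr add0r invr_gt0.
have [w_ w_P] := choice H.
exists w_ => [n|i]; first by have [] := w_P n.
apply: (@squeeze_cvgr _ _ _ _ (fun=> tnth w i) (fun n => tnth w i + n.+1%:R^-1)).
- near=> n; have [+ _] := w_P n => /(_ i); by rewrite !tnth_mktuple.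
- exact: cvg_cst.
- rewrite -[X in _ --> X]addr0; apply: cvgD; first exact: cvg_cst.
  exact: cvg_harmonic.
Unshelve. all: by end_near. Qed.

Lemma integrable_prod_trigpoly (p q : {finite_measure set Rd -> \bar R})
    (a b : Rd -> R) :
  trigpoly a -> trigpoly b ->
  (p \x q)%E.-integrable setT (fun z : Rd * Rd => (a z.1 * b z.2)%:E).
Proof.
move=> ta tb; have [A aA] := bounded_trigpoly ta; have [B bB] := bounded_trigpoly tb.
have pq : ((p \x q) setT < +oo)%E.
  by rewrite -setXTT product_measure1E// ltey_eq fin_numM// fin_num_measure.
apply: (@bounded_integrable _ _ _ _ pq (fun z => a z.1 * b z.2) (A * B)) => [|z].
  by apply: measurable_funM; apply: measurableT_comp => //; exact: measurable_trigpoly.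
by rewrite normrM ler_pM.
Qed.

Lemma Rintegral_prodM (p q : {finite_measure set Rd -> \bar R}) (a b : Rd -> R) :
  trigpoly a -> trigpoly b ->
  \int[(p \x q)%E]_z (a z.1 * b z.2) = (\int[p]_x a x) * (\int[q]_x b x).
Proof.
move=> ta tb; have iz := integrable_prod_trigpoly p q ta tb.
apply: EFin_inj; rewrite EFin_Rintegral// -integral12_prod_meas1//.
rewrite /fubini_F/=.
under eq_integral => x _.
  rewrite (_ : (\int[q]_y _)%E = (a x)%:E * (\int[q]_y b y)%:E)%E; last first.
    rewrite EFin_Rintegral; last exact: integrable_trigpoly.
    by rewrite -integralZl//; exact: integrable_trigpoly.
  over.
rewrite /= integralZr//; last exact: integrable_trigpoly.
by rewrite EFinM -EFin_Rintegral//; exact: integrable_trigpoly.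
Qed.

(** The real part of the product of the two characteristic functions, by Fubini and the addition
    formula; [sinint_tadd] is the imaginary part. *)
Lemma cosint_tadd (p q : {finite_measure set Rd -> \bar R}) w :
  \int[(p \x q)%E]_z cos (tdot w (tadd z.1 z.2)) =
  cosint p w * cosint q w - sinint p w * sinint q w.
Proof.
have tc := trigpoly_cos w; have ts := trigpoly_sin w.
rewrite /cosint /sinint -(Rintegral_prodM p q tc tc) -(Rintegral_prodM p q ts ts).
rewrite -(RintegralB measurableT (integrable_prod_trigpoly p q tc tc)
  (integrable_prod_trigpoly p q ts ts)).
by apply: eq_Rintegral => z _; rewrite tdotDr cosD.
Qed.

Lemma sinint_tadd (p q : {finite_measure set Rd -> \bar R}) w :
  \int[(p \x q)%E]_z sin (tdot w (tadd z.1 z.2)) =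
  sinint p w * cosint q w + cosint p w * sinint q w.
Proof.
have tc := trigpoly_cos w; have ts := trigpoly_sin w.
rewrite /cosint /sinint -(Rintegral_prodM p q ts tc) -(Rintegral_prodM p q tc ts).
rewrite -(RintegralD measurableT (integrable_prod_trigpoly p q ts tc)
  (integrable_prod_trigpoly p q tc ts)).
by apply: eq_Rintegral => z _; rewrite tdotDr sinD.
Qed.

(** Both sides are integrals of [f] against images under addition, and the hypothesis says that
    these images agree. *)
Lemma Rintegral_tadd_eq (p q nu : {finite_measure set Rd -> \bar R}) f :
  (forall A, measurable A -> (p \x nu)%E [set z | A (tadd z.1 z.2)] =
                             (q \x nu)%E [set z | A (tadd z.1 z.2)]) ->
  trigpoly f ->
  \int[(p \x nu)%E]_z f (tadd z.1 z.2) = \int[(q \x nu)%E]_z f (tadd z.1 z.2).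
Proof.
move=> pq tf; have [M fM] := bounded_trigpoly tf; have mf := measurable_trigpoly tf.
pose s (z : Rd * Rd) := tadd z.1 z.2.
have ms : measurable_fun setT s := measurable_tadd.
have H (r : {finite_measure set Rd -> \bar R}) :
    (\int[r \x nu]_z (f (tadd z.1 z.2))%:E =
     \int[pushforward (r \x nu) s]_y (f y)%:E)%E.
  rewrite (integral_pushforward ms)//; first exact/measurable_EFinP.
  rewrite preimage_setT.
  have rn : ((r \x nu) setT < +oo)%E.
    by rewrite -setXTT product_measure1E// ltey_eq fin_numM// fin_num_measure.
  apply: (@bounded_integrable _ _ _ _ rn (f \o s) M) => [|z]; last exact: fM.
  exact: measurableT_comp.
congr fine; rewrite !H; apply: eq_measure_integral => A mA _.
exact: pq.
Qed.

End characteristic_functions.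

(** * Injectivity of convolution on positive measures *)

Section deconvolution.
Context {R : realType} {d : nat}.
Local Notation Rd := (d.-tuple R).
Variable leb : {measure set Rd -> \bar R}.
Hypothesis lebP : is_lebesgue leb.
Variables (nu : probability Rd R) (f : Rd -> R).
Hypothesis nuf : is_density leb nu f.
Hypothesis nu0 : {ae leb, forall w, cosint nu w != 0 \/ sinint nu w != 0}.
Variables p q : {finite_measure set Rd -> \bar R}.
Hypothesis pq : {ae leb, forall y, econv p f y = econv q f y}.

Let sums_eq A : measurable A -> (p \x nu)%E [set z | A (tadd z.1 z.2)] =
                               (q \x nu)%E [set z | A (tadd z.1 z.2)].
Proof.
move=> mA; rewrite -!(integral_econv lebP nuf)//.
apply: ae_eq_integral => //.
- exact: measurable_funTS (measurable_econv nuf p).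
- exact: measurable_funTS (measurable_econv nuf q).
- by apply: filterS pq => y.
Qed.

Let charfun_eq w : cosint nu w != 0 \/ sinint nu w != 0 ->
  cosint p w = cosint q w /\ sinint p w = sinint q w.
Proof.
move=> nz.
have Hc := Rintegral_tadd_eq sums_eq (trigpoly_cos w).
have Hs := Rintegral_tadd_eq sums_eq (trigpoly_sin w).
rewrite !cosint_tadd in Hc; rewrite !sinint_tadd in Hs.
move: Hc Hs nz; move: (cosint p w) (cosint q w) (sinint p w) (sinint q w).
move: (cosint nu w) (sinint nu w) => c s a a' b b' Hc Hs nz.
have n0 : c ^+ 2 + s ^+ 2 != 0.
  rewrite paddr_eq0 ?sqr_ge0// !sqrf_eq0 negb_and; exact/orP.
(* The two equations say that the difference of the characteristic functions of [p] and [q],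
   multiplied by [c + i s], vanishes. Multiplying by the conjugate [c - i s] isolates its real part
   here and its imaginary part in [Hb]. *)
have Ha : (a - a') * (c ^+ 2 + s ^+ 2) = 0.
  rewrite (_ : _ * _ = ((a * c - b * s) - (a' * c - b' * s)) * c +
    ((b * c + a * s) - (b' * c + a' * s)) * s); last by ring.
  by rewrite Hc Hs !subrr !mul0r addr0.
have Hb : (b - b') * (c ^+ 2 + s ^+ 2) = 0.
  rewrite (_ : _ * _ = ((b * c + a * s) - (b' * c + a' * s)) * c -
    ((a * c - b * s) - (a' * c - b' * s)) * s); last by ring.
  by rewrite Hc Hs !subrr !mul0r subr0.
by split; apply/eqP; rewrite -subr_eq0;
  [move/eqP: Ha|move/eqP: Hb]; rewrite mulf_eq0 (negbTE n0) orbF.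
Qed.

(** [charfun_eq] holds almost everywhere; sequences of good frequencies and sequential continuity
    extend it to all [w], as [Rintegral_charfun_unique] requires. *)
Lemma econv_inj (h : Rd -> R) M :
  (forall x, `|h x| <= M) -> tcontinuous h -> \int[p]_x h x = \int[q]_x h x.
Proof.
apply: Rintegral_charfun_unique => w.
- have [w_ Qw ww] := is_lebesgue_ae_dense lebP nu0 w.
  have hp := cosint_cvg (p := p) ww; apply: (cvg_unique _ hp) => //.
  rewrite (_ : (fun n => _) = (fun n => cosint q (w_ n))); first exact: cosint_cvg.
  by apply/funext => n; have [] := charfun_eq (Qw n).
- have [w_ Qw ww] := is_lebesgue_ae_dense lebP nu0 w.
  have hp := sinint_cvg (p := p) ww; apply: (cvg_unique _ hp) => //.
  rewrite (_ : (fun n => _) = (fun n => sinint q (w_ n))); first exact: sinint_cvg.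
  by apply/funext => n; have [] := charfun_eq (Qw n).
Qed.

End deconvolution.

(** * Functions vanishing at infinity *)

Section complex_numbers.
Context {R : realType}.
Implicit Types z : R[i].

Lemma cnormE z : cnorm z = Num.sqrt (creal z ^+ 2 + cimag z ^+ 2).
Proof. by case: z. Qed.

Lemma cnorm_ge0 z : 0 <= cnorm z.
Proof. by rewrite cnormE sqrtr_ge0. Qed.

Lemma norm_creal_le z : `|creal z| <= cnorm z.
Proof. by rewrite cnormE -sqrtr_sqr ler_wsqrtr// lerDl sqr_ge0. Qed.

Lemma norm_cimag_le z : `|cimag z| <= cnorm z.
Proof. by rewrite cnormE -sqrtr_sqr ler_wsqrtr// lerDr sqr_ge0. Qed.

Lemma cnorm_le_sum z : cnorm z <= `|creal z| + `|cimag z|.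
Proof.
rewrite cnormE -[leRHS]ger0_norm ?addr_ge0// -sqrtr_sqr ler_wsqrtr//.
rewrite -(real_normK (num_real (creal z))) -(real_normK (num_real (cimag z))).
by rewrite sqrrD lerD2r lerDl mulrn_wge0// mulr_ge0.
Qed.

Lemma crealB z z' : creal (z - z') = creal z - creal z'.
Proof. by case: z; case: z'. Qed.

Lemma cimagB z z' : cimag (z - z') = cimag z - cimag z'.
Proof. by case: z; case: z'. Qed.

Lemma crealZ (k : R) z : creal (k%:C%C * z) = k * creal z.
Proof. by case: z => a b /=; rewrite mul0r subr0. Qed.

Lemma cimagZ (k : R) z : cimag (k%:C%C * z) = k * cimag z.
Proof. by case: z => a b /=; rewrite mul0r addr0. Qed.

Lemma cnormZ (k : R) z : cnorm (k%:C%C * z) = `|k| * cnorm z.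
Proof.
by rewrite !cnormE crealZ cimagZ !exprMn -mulrDr sqrtrM ?sqr_ge0// sqrtr_sqr.
Qed.

Lemma complex_ext z z' : creal z = creal z' -> cimag z = cimag z' -> z = z'.
Proof. by case: z => a b; case: z' => a' b' /= -> ->. Qed.

End complex_numbers.

Section C0.
Context {R : realType} {d : nat}.
Local Notation Rd := (d.-tuple R).

(** The function is transported to row vectors, where the closed cube is compact and its continuous
    image bounded. *)
Lemma tcontinuous_bounded (h : Rd -> R) (L : R) : tcontinuous h ->
  exists M, forall x, tnorm x <= L -> `|h x| <= M.
Proof.
move=> hc.
pose K := [set v : 'rV[R]_d | forall i, `[- L, L] (v ord0 i)].
have cK : compact K.
  apply: (@rV_compact _ _ (fun=> `[- L, L]%classic)) => _.
  exact: segment_compact.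
pose g (v : 'rV[R]_d) : R := h [tuple v ord0 i | i < d].
have cg : continuous g.
  move=> v; apply/(@cvgrPdist_lt _ _ _ (nbhs v) (nbhs_filter v)) => e e0.
  have [delta delta0 H] := hc [tuple v ord0 i | i < d] e e0.
  exists (fun i j => ball (v i j) delta) => [i j|v' vv'] /=.
    exact: nbhsx_ballx.
  rewrite distrC; apply: H; apply/tnorm_ltP => // i.
  by rewrite !tnth_mktuple distrC; exact: vv'.
have /compact_bounded[M [_ /(_ (M + 1))]] :=
  continuous_compact (continuous_subspaceT cg) cK.
rewrite ltrDl => /(_ ltr01) HM; exists (M + 1) => x xL.
have L0 : 0 <= L := le_trans (tnorm_ge0 x) xL.
apply: HM; exists (\row_i tnth x i).
  by move=> i /=; rewrite mxE in_itv/= -ler_norml; exact/tnorm_leP.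
by rewrite /g; congr h; apply: eq_from_tnth => i; rewrite tnth_mktuple mxE.
Qed.

Variable lam : Rd -> R[i].
Hypothesis lamC0 : C0fun lam.

Lemma C0fun_creal : tcontinuous (fun x => creal (lam x)).
Proof.
move=> x e e0; have [delta delta0 H] := lamC0.1 x e e0.
by exists delta => // y /H; apply: le_lt_trans; rewrite -crealB norm_creal_le.
Qed.

Lemma C0fun_cimag : tcontinuous (fun x => cimag (lam x)).
Proof.
move=> x e e0; have [delta delta0 H] := lamC0.1 x e e0.
by exists delta => // y /H; apply: le_lt_trans; rewrite -cimagB norm_cimag_le.
Qed.

Lemma C0fun_bounded : exists2 M : R, 0 < M & forall x, cnorm (lam x) <= M.
Proof.
have [L HL] := lamC0.2 1 ltr01.
have [A HA] := tcontinuous_bounded L C0fun_creal.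
have [B HB] := tcontinuous_bounded L C0fun_cimag.
(* [A] and [B] may be negative when [L] is, hence the absolute values; the 1 covers the outside of
   the ball and keeps the bound positive, which allows dividing by it. *)
exists (`|A| + `|B| + 1) => [|x]; first by rewrite ltr_wpDl// addr_ge0.
have [xL|Lx] := leP (tnorm x) L.
  rewrite (le_trans (cnorm_le_sum _))//.
  have := ler_norm A; have := ler_norm B.
  by have := HA x xL; have := HB x xL; lra.
have := ltW (HL x Lx); have := normr_ge0 A; have := normr_ge0 B; lra.
Qed.

Lemma C0funZ (k : R) : C0fun (fun x => k%:C%C * lam x).
Proof.
(* Dividing by [|k| + 1] also covers [k = 0], used later to obtain the zero function. *)
have k0 : 0 < `|k| + 1 by rewrite ltr_wpDl.
have kk : `|k| <= `|k| + 1 by rewrite lerDl.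
split=> [x e e0|e e0].
  have [delta delta0 H] := lamC0.1 x (e / (`|k| + 1)) ltac:(by rewrite divr_gt0).
  exists delta => // y /H; rewrite ltr_pdivlMr// => H'.
  rewrite -mulrBr cnormZ; apply: le_lt_trans H'.
  by rewrite mulrC ler_wpM2l// cnorm_ge0.
have [M H] := lamC0.2 (e / (`|k| + 1)) ltac:(by rewrite divr_gt0).
exists M => x /H; rewrite ltr_pdivlMr// => H'.
rewrite cnormZ; apply: le_lt_trans H'.
by rewrite mulrC ler_wpM2l// cnorm_ge0.
Qed.

End C0.

(** * Complex measures *)

Section finite_measure_operations.
Context {dT} {T : measurableType dT} {R : realType}.
Implicit Types m p q : {finite_measure set T -> \bar R}.

Section addition.
Variables p q : {finite_measure set T -> \bar R}.

(** The sum is repackaged with its finiteness, because the components of a [cmeasure] must be finite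
    measures. *)
Definition fmadd : set T -> \bar R := measure_add p q.

HB.instance Definition _ := Measure.on fmadd.

Let fmadd_fin : fin_num_fun fmadd.
Proof.
by move=> A mA; rewrite /fmadd measure_addE fin_numD; apply/andP; split;
  exact: fin_num_measure.
Qed.

HB.instance Definition _ := Measure_isFinite.Build _ T R fmadd fmadd_fin.

Lemma Rintegral_fmadd f : p.-integrable setT (EFin \o f) ->
  q.-integrable setT (EFin \o f) ->
  \int[fmadd]_x f x = (\int[p]_x f x) + (\int[q]_x f x).
Proof.
move=> pf qf; rewrite /Rintegral integral_measure_add// fineD//;
  exact: integrable_fin_num.
Qed.
End addition.

Definition fmscale (k : {nonneg R}) m : {finite_measure set T -> \bar R} :=
  mscale k m.

Lemma Rintegral_fmscale k m f : m.-integrable setT (EFin \o f) ->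
  \int[fmscale k m]_x f x = k%:num * \int[m]_x f x.
Proof.
move=> mf.
have mp := integrable_funepos measurableT mf.
have mn := integrable_funeneg measurableT mf.
have mf' := measurable_int _ mf.
rewrite /Rintegral integralE [in RHS]integralE.
rewrite !ge0_integral_mscale//; [|exact: measurable_funeneg|exact: measurable_funepos].
rewrite -muleBr// ?fineM//.
- by rewrite fin_numB; apply/andP; split; exact: integrable_fin_num.
- by apply: fin_num_adde_defr; exact: integrable_fin_num.
Qed.

End finite_measure_operations.

Section complex_measures.
Context {R : realType} {d : nat}.
Local Notation Rd := (d.-tuple R).
Local Notation cmeasure := (@cmeasure R d).
Implicit Types (mu nu : cmeasure) (h : Rd -> R[i]).

Let finite_lty (p : {finite_measure set Rd -> \bar R}) : (p setT < +oo)%E.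
Proof. by rewrite ltey_eq fin_num_measure. Qed.

Definition cmadd mu nu := CMeasure
  (fmadd (cm_rpos mu) (cm_rpos nu)) (fmadd (cm_rneg mu) (cm_rneg nu))
  (fmadd (cm_ipos mu) (cm_ipos nu)) (fmadd (cm_ineg mu) (cm_ineg nu)).
Definition cmscale k mu := CMeasure
  (fmscale k (cm_rpos mu)) (fmscale k (cm_rneg mu))
  (fmscale k (cm_ipos mu)) (fmscale k (cm_ineg mu)).
(** Exchanging positive and negative components changes the sign without subtracting measures. *)
Definition cmopp mu :=
  CMeasure (cm_rneg mu) (cm_rpos mu) (cm_ineg mu) (cm_ipos mu).
(** Multiplication by [i]: the imaginary component moves to the real one with its sign reversed. *)
Definition cmrot mu :=
  CMeasure (cm_ineg mu) (cm_ipos mu) (cm_rpos mu) (cm_rneg mu).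

Definition integrable2 (m : {finite_measure set Rd -> \bar R}) h :=
  m.-integrable setT (EFin \o (fun x => creal (h x))) /\
  m.-integrable setT (EFin \o (fun x => cimag (h x))).

(** Under this condition [cint] is additive in the measure; an infinite integral would be read as 0
    by [Rintegral]. *)
Definition cintegrable mu h :=
  [/\ integrable2 (cm_rpos mu) h, integrable2 (cm_rneg mu) h,
      integrable2 (cm_ipos mu) h & integrable2 (cm_ineg mu) h].

Lemma cint_cmadd mu nu h : cintegrable mu h -> cintegrable nu h ->
  cint (cmadd mu nu) h = cint mu h + cint nu h.
Proof.
move=> [[a1 b1] [a2 b2] [a3 b3] [a4 b4]] [[c1 d1] [c2 d2] [c3 d3] [c4 d4]].
rewrite /cint/= !Rintegral_fmadd//.
by apply: complex_ext => /=; ring.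
Qed.

Lemma cint_cmscale k mu h : cintegrable mu h ->
  cint (cmscale k mu) h = k%:num%:C%C * cint mu h.
Proof.
move=> [[a1 b1] [a2 b2] [a3 b3] [a4 b4]].
rewrite /cint/= !Rintegral_fmscale//.
by apply: complex_ext; rewrite ?crealZ ?cimagZ/=; ring.
Qed.

Lemma cint_cmopp mu h : cint (cmopp mu) h = - cint mu h.
Proof. by apply: complex_ext => /=; ring. Qed.

Lemma cint_cmrot mu h : cint (cmrot mu) h = 'i%C * cint mu h.
Proof. by apply: complex_ext => /=; ring. Qed.

Lemma cintZ (k : R) mu h : cintegrable mu h ->
  cint mu (fun x => k%:C%C * h x) = k%:C%C * cint mu h.
Proof.
move=> [[a1 b1] [a2 b2] [a3 b3] [a4 b4]].
have E1 : (fun x => creal (k%:C%C * h x)) = (fun x => k * creal (h x)).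
  by apply/funext => x; rewrite crealZ.
have E2 : (fun x => cimag (k%:C%C * h x)) = (fun x => k * cimag (h x)).
  by apply/funext => x; rewrite cimagZ.
rewrite /cint E1 E2 !RintegralZl//.
by apply: complex_ext; rewrite ?crealZ ?cimagZ/=; ring.
Qed.

Lemma C0fun_integrable2 h m : C0fun h -> integrable2 m h.
Proof.
move=> hC; have [M _ hM] := C0fun_bounded hC.
have aM x : `|creal (h x)| <= M by rewrite (le_trans (norm_creal_le _)).
have bM x : `|cimag (h x)| <= M by rewrite (le_trans (norm_cimag_le _)).
split; [apply: (bounded_integrable (finite_lty m) _ aM)|
        apply: (bounded_integrable (finite_lty m) _ bM)].
- exact: tcontinuous_measurable aM (C0fun_creal hC).
- exact: tcontinuous_measurable bM (C0fun_cimag hC).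
Qed.

Lemma C0fun_cintegrable mu h : C0fun h -> cintegrable mu h.
Proof. by move=> hC; split; exact: C0fun_integrable2. Qed.

Lemma norm_Rintegral_le1 (m : {finite_measure set Rd -> \bar R}) (f : Rd -> R) :
  m.-integrable setT (EFin \o f) -> (forall x, `|f x| <= 1) ->
  `|\int[m]_x f x| <= fine (m setT).
Proof.
move=> mf f1; rewrite (le_trans (le_normr_Rintegral _ _))//.
rewrite -[leRHS]mul1r -Rintegral_cst//; apply: le_Rintegral => //.
- exact: integrable_norm.
- by apply: (bounded_integrable (finite_lty m) (M := 1)) => // x; rewrite normr1.
Qed.

(** It bounds the set in [tvnorm], whose [sup] is thus a true supremum. Real and imaginary parts are
    each at most the sum of the four total masses, hence the factor [1 + 1]. *)
Lemma cnorm_cint_le mu : exists B, forall h, C0fun h ->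
  (forall x, cnorm (h x) <= 1) -> cnorm (cint mu h) <= B.
Proof.
pose s (m : {finite_measure set Rd -> \bar R}) := fine (m setT).
exists ((1 + 1) * (s (cm_rpos mu) + s (cm_rneg mu) + s (cm_ipos mu) + s (cm_ineg mu))).
move=> h hC h1; rewrite (le_trans (cnorm_le_sum _))//.
have H (m : {finite_measure set Rd -> \bar R}) :
    `|\int[m]_x creal (h x)| <= s m /\ `|\int[m]_x cimag (h x)| <= s m.
  have [mr mi] := C0fun_integrable2 m hC.
  split; apply: norm_Rintegral_le1 => // x.
    by rewrite (le_trans (norm_creal_le _)).
  by rewrite (le_trans (norm_cimag_le _)).
rewrite /cint/=.
have [/ler_normlP[? ?] /ler_normlP[? ?]] := H (cm_rpos mu).
have [/ler_normlP[? ?] /ler_normlP[? ?]] := H (cm_rneg mu).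
have [/ler_normlP[? ?] /ler_normlP[? ?]] := H (cm_ipos mu).
have [/ler_normlP[? ?] /ler_normlP[? ?]] := H (cm_ineg mu).
rewrite [leRHS]mulrDl mul1r.
by apply: lerD; rewrite ler_norml; apply/andP; split; lra.
Qed.

Lemma cnorm_cint_le_tvnorm mu h (M : R) : C0fun h -> 0 < M ->
  (forall x, cnorm (h x) <= M) -> cnorm (cint mu h) <= M * tvnorm mu.
Proof.
move=> hC M0 hM; rewrite -ler_pdivrMl//.
have [B HB] := cnorm_cint_le mu.
apply: sup_upper_bound.
  split; last by exists B => _ [g [gC g1 ->]]; exact: HB.
  (* The zero function shows that the set of test values is inhabited. *)
  exists (cnorm (cint mu (fun x => 0%:C%C * h x))), (fun x => 0%:C%C * h x).
  by split=> [|x|//]; [exact: C0funZ|rewrite cnormZ normr0 mul0r].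
exists (fun x => (M^-1)%:C%C * h x); split => [|x|].
- exact: C0funZ.
- by rewrite cnormZ gtr0_norm ?invr_gt0// ler_pdivrMl// mulr1.
- by rewrite cintZ ?cnormZ ?gtr0_norm ?invr_gt0//; exact: C0fun_cintegrable.
Qed.

End complex_measures.

(** * Admissible mixtures *)

Section admissible_mixtures.
Context {R : realType} {d : nat}.
Local Notation Rd := (d.-tuple R).
Local Notation cmeasure := (@cmeasure R d).
Variable leb : {measure set Rd -> \bar R}.
Hypothesis lebP : is_lebesgue leb.
Variables (nu : probability Rd R) (f : Rd -> R).
Hypothesis nuf : is_density leb nu f.
Implicit Types (mu : cmeasure) (g : Rd -> R[i]).

Lemma creal_Kconv mu y : creal (Kconv f mu y) =
  fine (econv (cm_rpos mu) f y) - fine (econv (cm_rneg mu) f y).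
Proof. by rewrite /Kconv /cint/= !Rintegral_cst// !mul0r !subr0. Qed.

Lemma cimag_Kconv mu y : cimag (Kconv f mu y) =
  fine (econv (cm_ipos mu) f y) - fine (econv (cm_ineg mu) f y).
Proof. by rewrite /Kconv /cint/= !Rintegral_cst// !mul0r !subr0 add0r. Qed.

(** The kernel is nonnegative, so it is integrable at each [y] where [econv m f y] is finite. This
    is only almost every [y], so sums of mixtures are handled up to null sets. *)
Lemma ae_integrable2_kernel (m : {finite_measure set Rd -> \bar R}) :
  {ae leb, forall y, integrable2 m (fun x => (f (tsub y x))%:C%C)}.
Proof.
have := econv_fin_num lebP nuf m; apply: filterS => y yfin.
have f0 x : 0 <= f x by case: nuf.
split; last first.
  rewrite (_ : EFin \o _ = cst 0%E); last exact/funext.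
  exact: integrable0.
apply/integrableP; split; first exact: measurable_translate_density nuf y.
rewrite (eq_integral (fun x => (f (tsub y x))%:E)).
  by rewrite -[X in (X < _)%E]/(econv m f y) ltey_eq yfin.
by move=> x _ /=; rewrite ger0_norm.
Qed.

Lemma ae_cintegrable_kernel mu :
  {ae leb, forall y, cintegrable mu (fun x => (f (tsub y x))%:C%C)}.
Proof.
have H1 := ae_integrable2_kernel (cm_rpos mu).
have H2 := ae_integrable2_kernel (cm_rneg mu).
have H3 := ae_integrable2_kernel (cm_ipos mu).
have H4 := ae_integrable2_kernel (cm_ineg mu).
by apply: filterS3 H1 H2 (filterI H3 H4) => y ? ? [].
Qed.

Section signed_injectivity.
Hypothesis nu0 : {ae leb, forall w, cosint nu w != 0 \/ sinint nu w != 0}.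

(* Moving the negative parts across the equality reduces the injectivity of
   convolution on signed measures to positive ones. *)
Lemma signed_econv_inj (p p' q q' : {finite_measure set Rd -> \bar R})
    (h : Rd -> R) M :
  {ae leb, forall y, fine (econv p f y) - fine (econv p' f y) =
                     fine (econv q f y) - fine (econv q' f y)} ->
  (forall x, `|h x| <= M) -> tcontinuous h ->
  (\int[p]_x h x) - (\int[p']_x h x) = (\int[q]_x h x) - (\int[q']_x h x).
Proof.
move=> pq hM hc.
have hi (m : {finite_measure set Rd -> \bar R}) : m.-integrable setT (EFin \o h).
  apply: (bounded_integrable _ (tcontinuous_measurable hM hc) hM).
  by rewrite ltey_eq fin_num_measure.
have : \int[fmadd p q']_x h x = \int[fmadd q p']_x h x.
  apply: (econv_inj lebP nuf nu0 _ hM hc).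
  have fin m := econv_fin_num lebP nuf m.
  apply: filterS3 pq (filterI (fin p) (fin p')) (filterI (fin q) (fin q')) =>
    y pqy [p1 p2] [q1 q2].
  have f0 x : 0 <= f x by case: nuf.
  have econvD m m' : econv (fmadd m m') f y = (econv m f y + econv m' f y)%E.
    apply: ge0_integral_measure_add => // [x _|]; first by rewrite lee_fin.
    exact: measurable_translate_density nuf y.
  rewrite !econvD -(fineK p1) -(fineK p2) -(fineK q1) -(fineK q2) -!EFinD.
  by congr EFin; lra.
rewrite !Rintegral_fmadd// => H.
by apply/eqP; rewrite subr_eq addrAC -subr_eq opprK H.
Qed.

(** The kernel is real, so the real and imaginary parts of the mixture see the corresponding
    components of the measure separately; each component is then tested against both parts of
    [lam]. *)
Lemma Kconv_inj mu mu' (lam : Rd -> R[i]) : C0fun lam ->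
  {ae leb, forall y, Kconv f mu y = Kconv f mu' y} -> cint mu lam = cint mu' lam.
Proof.
move=> lamC H.
have [M _ lamM] := C0fun_bounded lamC.
have aM x : `|creal (lam x)| <= M by rewrite (le_trans (norm_creal_le _)).
have bM x : `|cimag (lam x)| <= M by rewrite (le_trans (norm_cimag_le _)).
have ac := C0fun_creal lamC; have bc := C0fun_cimag lamC.
have Hr : {ae leb, forall y,
    fine (econv (cm_rpos mu) f y) - fine (econv (cm_rneg mu) f y) =
    fine (econv (cm_rpos mu') f y) - fine (econv (cm_rneg mu') f y)}.
  by apply: filterS H => y; rewrite -!creal_Kconv => ->.
have Hi : {ae leb, forall y,
    fine (econv (cm_ipos mu) f y) - fine (econv (cm_ineg mu) f y) =
    fine (econv (cm_ipos mu') f y) - fine (econv (cm_ineg mu') f y)}.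
  by apply: filterS H => y; rewrite -!cimag_Kconv => ->.
have ra := signed_econv_inj Hr aM ac; have rb := signed_econv_inj Hr bM bc.
have ia := signed_econv_inj Hi aM ac; have ib := signed_econv_inj Hi bM bc.
by rewrite /cint; congr Complex; rewrite ?ra ?rb ?ia ?ib.
Qed.

End signed_injectivity.

Section functional.
Variable lam : Rd -> R[i].
Hypothesis lamC : C0fun lam.

(** The graph of the functional. Linearity is proved on the graph, where any representing measure
    may be used, before a value is chosen. *)
Definition represents g (z : R[i]) :=
  exists2 mu, {ae leb, forall y, g y = Kconv f mu y} & cint mu lam = z.

Lemma representsD g g' z z' : represents g z -> represents g' z' ->
  represents (fun y => g y + g' y) (z + z').
Proof.
move=> [mu gmu <-] [mu' gmu' <-]; exists (cmadd mu mu').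
  apply: filterS3 gmu gmu' (filterI (ae_cintegrable_kernel mu)
    (ae_cintegrable_kernel mu')) => y -> -> [? ?].
  by rewrite /Kconv cint_cmadd.
by rewrite cint_cmadd//; exact: C0fun_cintegrable.
Qed.

Lemma representsN g z : represents g z -> represents (fun y => - g y) (- z).
Proof.
move=> [mu gmu <-]; exists (cmopp mu); last exact: cint_cmopp.
by apply: filterS gmu => y ->; rewrite /Kconv cint_cmopp.
Qed.

Lemma represents_rot g z : represents g z ->
  represents (fun y => 'i%C * g y) ('i%C * z).
Proof.
move=> [mu gmu <-]; exists (cmrot mu); last exact: cint_cmrot.
by apply: filterS gmu => y ->; rewrite /Kconv cint_cmrot.
Qed.

Let represents_nonneg (k : {nonneg R}) g z : represents g z ->
  represents (fun y => k%:num%:C%C * g y) (k%:num%:C%C * z).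
Proof.
move=> [mu gmu <-]; exists (cmscale k mu); last first.
  by rewrite cint_cmscale//; exact: C0fun_cintegrable.
apply: filterS2 gmu (ae_cintegrable_kernel mu) => y -> ?.
by rewrite /Kconv cint_cmscale.
Qed.

Lemma represents_real (k : R) g z : represents g z ->
  represents (fun y => k%:C%C * g y) (k%:C%C * z).
Proof.
move=> gz; have [k0|k0] := leP 0 k.
  exact: (represents_nonneg (NngNum k0) gz).
have k0' : 0 <= - k by rewrite oppr_ge0 ltW.
have := representsN (represents_nonneg (NngNum k0') gz).
rewrite /= (_ : (- k)%:C%C = - k%:C%C); last by rewrite rmorphN.
rewrite mulNr opprK; congr represents; apply/funext => y.
by rewrite mulNr opprK.
Qed.

(** A complex scalar splits into two real scalings and one rotation by [i]; real scalings reduce by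
    sign to nonnegative ones, the only ones under which positive measures are stable. *)
Lemma representsZ (a : R[i]) g z : represents g z ->
  represents (fun y => a * g y) (a * z).
Proof.
move=> gz; have E w : a * w = (creal a)%:C%C * w + 'i%C * ((cimag a)%:C%C * w).
  by case: a => r i /=; case: w => u v; apply: complex_ext => /=; ring.
rewrite E (_ : (fun y => _) =
  fun y => (creal a)%:C%C * g y + 'i%C * ((cimag a)%:C%C * g y)); last first.
  by apply/funext => y; rewrite E.
apply: representsD; first exact: represents_real.
exact/represents_rot/represents_real.
Qed.

End functional.
End admissible_mixtures.

(** * Random vectors *)

Section random_vectors.
Context {R : realType} {d : nat} {dO : measure_display}.
Context {Omega : measurableType dO} {P : probability Omega R}.
Local Notation Rd := (d.-tuple R).
Implicit Types X V : {RV P >-> Rd}.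

Lemma charfun_cosint_sinint V (w : Rd) : charfun P V w =
  Complex (cosint (distribution P V) w) (sinint (distribution P V) w).
Proof.
have [mc ms] := (measurable_trigpoly (trigpoly_cos w),
                 measurable_trigpoly (trigpoly_sin w)).
have Poo : (P setT < +oo)%E by rewrite probability_setT ltry.
congr Complex; congr fine; apply/esym.
- apply: integral_distribution; first exact/measurable_EFinP.
  apply: (bounded_integrable Poo (f := fun o => cos (tdot w (V o))) (M := 1)).
    exact: (measurableT_comp mc (measurable_funPT V)).
  by move=> o; rewrite ler_norml cos_geN1 cos_le1.
- apply: integral_distribution; first exact/measurable_EFinP.
  apply: (bounded_integrable Poo (f := fun o => sin (tdot w (V o))) (M := 1)).
    exact: (measurableT_comp ms (measurable_funPT V)).
  by move=> o; rewrite ler_norml sin_geN1 sin_le1.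
Qed.

(** Independence says that the joint law agrees with the product of the laws on rectangles, which
    determine it. *)
Lemma law_tadd X V (A : set Rd) : independent P X V -> measurable A ->
  law P (fun o => tadd (X o) (V o)) A =
  (distribution P X \x distribution P V)%E [set z | A (tadd z.1 z.2)].
Proof.
move=> XV mA.
have mXV : measurable_fun setT (fun o => (X o, V o)).
  exact: measurable_fun_pair.
pose m' : {measure set (Rd * Rd) -> \bar R} := pushforward P (fun o => (X o, V o)).
have mA' : measurable [set z : Rd * Rd | A (tadd z.1 z.2)].
  by rewrite -[X in measurable X]setTI; exact: measurable_tadd.
by apply/esym; exact: (product_measure_unique (m' := m' mXV)).
Qed.

End random_vectors.

(** * The deconvolution functional *)

Theorem theorem1 (R : realType) (d : nat) (dO : measure_display)
  (Omega : measurableType dO) (P : probability Omega R)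
  (leb : {measure set (d.-tuple R) -> \bar R})
  (V : {RV P >-> d.-tuple R}) (fV : d.-tuple R -> R) :
  is_lebesgue leb ->
  is_density leb (law P V) fV ->
  {ae leb, forall w, charfun P V w != 0} ->
  forall lam : d.-tuple R -> R[i], C0fun lam ->
  exists T : (d.-tuple R -> R[i]) -> R[i],
    [/\ AVdual leb fV T,
        (forall mu : cmeasure, T (Kconv fV mu) = cint mu lam),
        (forall T' : (d.-tuple R -> R[i]) -> R[i], AVdual leb fV T' ->
           (forall mu : cmeasure, T' (Kconv fV mu) = cint mu lam) ->
           forall f, inAV leb fV f -> T' f = T f) &
        (forall X : {RV P >-> d.-tuple R}, independent P X V ->
           let Y := fun o => tadd (X o) (V o) in
           let PX := cm_of (distribution P X) in
           [/\ is_density leb (law P Y) (fun y => creal (Kconv fV PX y)),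
               (forall y, cimag (Kconv fV PX y) = 0) &
               forall fY, is_density leb (law P Y) fY ->
                 T (fun y => (fY y)%:C%C) = cint PX lam])].
Proof.
move=> lebP Vf V0 lam lamC.
have nuf : is_density leb (distribution P V : probability _ _) fV by exact: Vf.
have nu0 : {ae leb, forall w, cosint (distribution P V) w != 0 \/
                              sinint (distribution P V) w != 0}.
  apply: filterS V0 => w; rewrite charfun_cosint_sinint => w0.
  apply/orP; rewrite -negb_and; apply: contra w0 => /andP[/eqP -> /eqP ->].
  by rewrite eqE/= !eqxx.
have rep_unique g z z' : represents leb fV lam g z -> represents leb fV lam g z' ->
    z = z'.
  move=> [mu gmu <-] [mu' gmu' <-]; apply: (Kconv_inj lebP nuf nu0 lamC).
  by apply: filterS2 gmu gmu' => y -> ->.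
(* The represented value is selected by choice, with 0 as a default outside [A_V]. *)
pose T g : R[i] := if pselect (exists z, represents leb fV lam g z) is left ex
  then projT1 (cid ex) else 0.
have TE g z : represents leb fV lam g z -> T g = z.
  move=> gz; rewrite /T; case: pselect => [ex|[]]; last by exists z.
  by case: cid => z' /= gz'; exact: rep_unique gz' gz.
have inAVE g : inAV leb fV g -> represents leb fV lam g (T g).
  by move=> [mu gmu]; have gz : represents leb fV lam g (cint mu lam);
    [exists mu|rewrite (TE _ _ gz)].
exists T; split.
- split.
  + move=> f g [mu fmu] fg; transitivity (cint mu lam); last apply/esym.
      by apply: TE; exists mu.
    by apply: TE; exists mu => //; apply: filterS2 fmu fg => y -> ->.
  + move=> f g a b /inAVE ft /inAVE gt; apply: TE.
    apply: (representsD lebP nuf lamC);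
      exact: (representsZ lebP nuf lamC).
  (* The constant is a bound of [lam]. Since [T f] can be computed with any representing measure,
     [cnorm (T f) / M] is a lower bound of all their total variations, hence of the infimum
     [AVnorm]. *)
  + have [M M0 lamM] := C0fun_bounded lamC.
    exists M => f [mu0 fmu0]; rewrite -ler_pdivrMl//.
    apply: lb_le_inf; first by exists (tvnorm mu0), mu0.
    move=> _ [mu fmu <-]; rewrite ler_pdivrMl//.
    rewrite (TE f (cint mu lam)); last by exists mu.
    exact: cnorm_cint_le_tvnorm.
- by move=> mu; apply: TE; exists mu => //; exact: aeW.
(* Every element of [A_V] is almost everywhere some [Kconv fV mu], where [T'] is prescribed, and
   [T'] respects almost everywhere equality. *)
- move=> T' [T'ae _ _] T'K f fAV; have [mu fmu] := fAV.
  by rewrite (T'ae _ _ fAV fmu) T'K; apply/esym/TE; exists mu.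
move=> X XV Y PX.
have KE y : creal (Kconv fV PX y) = fine (econv (distribution P X) fV y).
  rewrite creal_Kconv/= /econv integral_measure_zero subr0//.
have K0 y : cimag (Kconv fV PX y) = 0.
  by rewrite cimag_Kconv/= /econv integral_measure_zero subr0.
have KX : is_density leb (law P Y) (fun y => creal (Kconv fV PX y)).
  split.
  - under eq_fun do rewrite KE.
    apply: measurableT_comp => //; exact: (measurable_econv nuf).
  - by move=> y; rewrite KE fine_ge0// (econv_ge0 nuf).
  (* The law of [Y] has density [econv]; taking [fine] alters it only on the null set where it is
     infinite. *)
  - move=> A mA; rewrite (law_tadd XV)// -(integral_econv lebP nuf)//.
    apply: ae_eq_integral => //.
    + exact: measurable_funTS (measurable_econv nuf _).
    + apply/measurable_funTS/measurable_EFinP; under eq_fun do rewrite KE.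
      by apply: measurableT_comp => //; exact: (measurable_econv nuf).
    + have := econv_fin_num lebP nuf (distribution P X).
      by apply: filterS => y yfin _; rewrite KE fineK.
split => // fY [mfY fY0 fYE]; apply: TE; exists PX => //.
have [mK K0' KXE] := KX.
(* Two densities of the law of [Y] have equal integrals over every measurable set, so they agree
   almost everywhere; hence [PX] represents any density [fY]. *)
have : ae_eq leb setT (EFin \o fY) (EFin \o (fun y => creal (Kconv fV PX y))).
  apply: integral_ae_eq => //.
  - apply/integrableP; split; first exact/measurable_EFinP.
    under eq_integral do rewrite /= ger0_norm//.
    rewrite -fYE// /law preimage_setT probability_setT ltry//.
  - exact/measurable_EFinP.
  - by move=> E _ mE; rewrite -fYE// -KXE.
apply: filterS => y /(_ I)[fYy].
by apply: complex_ext; [exact: fYy|rewrite K0].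
Qed.
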